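(* Let $\mathcal{C}$ be the set of all bivariate copulas, and let $\Upsilon$, $\Lambda$, $n_b$, $A_w$, $B_b$ and the notion of upper extremizer be as defined in the context. Then \[ \{(\nu(C),\nu(C^\top)):C\in\mathcal{C}\}=\bigl\{(n,m)\in[-1,1]^2:\ |n-m|\le2\Upsilon\bigl(\tfrac{n+m}{2}\bigr)\bigr\}=\bigl\{(n,m)\in[-1,1]^2:\ \Lambda^{-1}(n)\le m\le\Lambda(n)\bigr\}. \] For every $n\in[-1,1]$, the maximum of $\nu(C^\top)$ over all copulas $C$ with $\nu(C)=n$ is $\Lambda(n)$, the minimum is $\Lambda^{-1}(n)$, and each is attained by exactly one copula. For $n=-1$, this copula is $W$. For $n\in(-1,1]$, the maximizer is the transpose of an upper extremizer, namely $A_w^\top$ with $w=(\frac{1+n}{2})^{1/4}$ if $n\ge-\frac78$, and $B_b^\top$ with $b\in(0,\frac12)$ such that $n_b=n$ if $n<-\frac78$; the minimizer is an upper extremizer itself, i.e. $A_w$ for some $w\in[\frac12,1]$ or $B_b$ for some $b\in(0,\frac12)$.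
   Context: A (bivariate) copula is (the restriction to $[0,1]^2$ of) a distribution function of a probability measure on $[0,1]^2$ with uniform marginals; $W(u,v)=\max\{u+v-1,0\}$. For a copula $C$, its transpose is $C^\top(u,v)=C(v,u)$, Blest's rank correlation is $\nu(C)=24\int_0^1\int_0^1(1-u)\,C(u,v)\,du\,dv-2$, and $\eta(C)=\frac{\nu(C)+\nu(C^\top)}{2}$. The function $\Upsilon:[-1,1]\to[0,\frac{27}{128}]$: $\Upsilon(-1)=0$; $\Upsilon(e)=(1+e)-2^{-1/3}(1+e)^{4/3}$ for $e\in[-\frac34,1]$; and on $(-1,-\frac34)$ parametrically $\Upsilon(e_b)=\frac{b^3(6b^2-15b+8)}{8(1-b)^2}$ with $e_b=-1+\frac{b^3(2b^2-9b+8)}{8(1-b)^2}$, $b\in(0,\frac12)$ (here $b\mapsto e_b$ is an increasing bijection from $(0,\frac12)$ onto $(-1,-\frac34)$). The function $\Lambda:[-1,1]\to[-1,1]$: $\Lambda(-1)=-1$; $\Lambda(n)=4\bigl(\frac{1+n}{2}\bigr)^{3/4}-n-2$ for $n\in[-\frac78,1]$; and on $(-1,-\frac78)$ parametrically $\Lambda(n_b)=-1+\frac{(2-b)b^3}{1-b}$ with $n_b=-1+\frac{b^4(3-2b)}{4(1-b)^2}$, $b\in(0,\frac12)$. (Here $b\mapsto n_b$ is an increasing bijection from $(0,\frac12)$ onto $(-1,-\frac78)$, and $\Lambda$ is a strictly increasing bijection of $[-1,1]$, with inverse $\Lambda^{-1}$.) Copulas $A_w$, $w\in[0,1]$: $A_w$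 is the joint distribution function of $(1-X,1-T_w(X))$ with $X$ uniform on $[0,1]$, where $T_w(x)=1-x$ for $0\le x\le1-w$ and $T_w(x)=x+w-1$ for $1-w<x\le1$. Copulas $B_b$, $b\in(0,\frac12)$: with $z_b=\frac{b}{2(1-b)}$, $B_b$ is the joint distribution function of $(1-R_b(Z),1-Z)$ with $Z$ uniform on $[0,1]$, where $R_b(z)=2(1-b)z+1-b$ for $0\le z\le z_b$, $R_b(z)=\frac{(1-b)(1-2z)}{1-2b}$ for $z_b<z\le b$, and $R_b(z)=1-z$ for $b<z\le1$. An upper extremizer is a copula $C$ with $\nu(C)=\eta(C)+\Upsilon(\eta(C))$. For each $e\in(-1,1]$ there is exactly one with $\eta(C)=e$: it is $A_w$ with $w=(\frac{1+e}{2})^{1/3}\in[\frac12,1]$ if $e\ge-\frac34$, and $B_b$ with $e_b=e$ if $e<-\frac34$. *)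

(* Defs.v *)
From HB Require Import structures.
From mathcomp Require Export all_boot all_order all_algebra.
From mathcomp Require Export all_classical all_reals all_analysis.

Set Implicit Arguments.
Unset Strict Implicit.
Unset Printing Implicit Defensive.

Import Order.TTheory GRing.Theory Num.Theory.
Import numFieldNormedType.Exports.

Local Open Scope classical_set_scope.
Local Open Scope ring_scope.

Section copulas.
Context {R : realType}.
Implicit Types (C D : R -> R -> R) (u v x z w b e n m : R).

Definition unif01 : probability (measurableTypeR R) R := uniform_prob (@ltr01 R).

Definition joint_cdf d (T : measurableType d) (P : probability T R)
    (X Y : T -> R) : R -> R -> R :=
  fun u v => fine (P [set t | X t <= u /\ Y t <= v]).

(* Only the restriction of C to the unit square is constrained; accordingly,
   copulas are compared with [eq_copula] below. *)
Definition is_copula C : Prop :=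
  exists P : probability (measurableTypeR R * measurableTypeR R)%type R,
    [/\ P (`[0, 1] `*` `[0, 1]) = 1%:E,
        forall A : set (measurableTypeR R), measurable A ->
          P (fst @^-1` A) = unif01 A,
        forall A : set (measurableTypeR R), measurable A ->
          P (snd @^-1` A) = unif01 A
      & {in `[0, 1] &, forall u v, C u v = joint_cdf P fst snd u v}].

Definition eq_copula C D : Prop := {in `[0, 1] &, forall u v, C u v = D u v}.

Definition W_copula : R -> R -> R := fun u v => Num.max (u + v - 1) 0.

Definition transpose C : R -> R -> R := fun u v => C v u.

Definition blest C : R :=
  24 * (\int[lebesgue_measure]_(v in `[0, 1])
          \int[lebesgue_measure]_(u in `[0, 1]) ((1 - u) * C u v)) - 2.

Definition eta C : R := (blest C + blest (transpose C)) / 2.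

Definition b_range : set R := `]0, (1 / 2)[.

Definition e_param b : R :=
  -1 + b ^+ 3 * (2 * b ^+ 2 - 9 * b + 8) / (8 * (1 - b) ^+ 2).

Definition upsilon_param b : R :=
  b ^+ 3 * (6 * b ^+ 2 - 15 * b + 8) / (8 * (1 - b) ^+ 2).

(* On ]-1, -3/4[ the parameter b is recovered from e by inverting the bijection
   e_param from ]0, 1/2[ onto ]-1, -3/4[; values off [-1, 1] are irrelevant. *)
Definition Upsilon e : R :=
  if e == -1 then 0
  else if - (3 / 4) <= e
       then (1 + e) - 2 `^ (- (1 / 3)) * (1 + e) `^ (4 / 3)
       else upsilon_param (pinv b_range e_param e).

Definition n_param b : R :=
  -1 + b ^+ 4 * (3 - 2 * b) / (4 * (1 - b) ^+ 2).

Definition lambda_param b : R := -1 + (2 - b) * b ^+ 3 / (1 - b).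

(* As for Upsilon: n_param is a bijection from ]0, 1/2[ onto ]-1, -7/8[. *)
Definition Lambda n : R :=
  if n == -1 then -1
  else if - (7 / 8) <= n
       then 4 * ((1 + n) / 2) `^ (3 / 4) - n - 2
       else lambda_param (pinv b_range n_param n).

Definition Lambda_inv : R -> R := pinv (`[-1, 1] : set R) Lambda.

Definition T_map w x : R := if x <= 1 - w then 1 - x else x + w - 1.

Definition A_copula w : R -> R -> R :=
  joint_cdf unif01 (fun x => 1 - x) (fun x => 1 - T_map w x).

Definition z_param b : R := b / (2 * (1 - b)).

Definition R_map b z : R :=
  if z <= z_param b then 2 * (1 - b) * z + 1 - b
  else if z <= b then (1 - b) * (1 - 2 * z) / (1 - 2 * b)
  else 1 - z.

Definition B_copula b : R -> R -> R :=
  joint_cdf unif01 (fun z => 1 - R_map b z) (fun z => 1 - z).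

Definition upper_extremizer C : Prop :=
  is_copula C /\ blest C = eta C + Upsilon (eta C).

Definition blest_transpose_values n : set R :=
  [set blest (transpose C) | C in [set C | is_copula C /\ blest C = n]].

Definition is_maximum (S : set R) x : Prop := S x /\ ubound S x.

Definition is_minimum (S : set R) x : Prop := S x /\ lbound S x.

Definition maximizer n C : Prop :=
  [/\ is_copula C, blest C = n
    & is_maximum (blest_transpose_values n) (blest (transpose C))].

Definition minimizer n C : Prop :=
  [/\ is_copula C, blest C = n
    & is_minimum (blest_transpose_values n) (blest (transpose C))].

Definition exactly_one_copula (Q : (R -> R -> R) -> Prop) : Prop :=
  exists C, Q C /\ forall D, Q D -> eq_copula D C.

End copulas.

(* Main.v *)
(* With X = 1 - U and Y = 1 - V one has nu(C) = 12 E[X^2 Y] - 2 and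
   nu(C^T) = 12 E[X Y^2] - 2, so the boundary of the region is found by maximizing
   E[X^2 Y - mu X Y^2] over couplings of two uniform variables, for each
   multiplier mu.  This transport problem is solved by duality: for a transport
   map F preserving the uniform law and a potential g such that
   g(y) - c(x, y) is minimized in y at y = F(x), the coupling (X, F(X)) is optimal,
   and it is the only optimizer when the minimizer is unique up to null sets.  The
   map T_w is optimal for mu = (3 - 2 w) / (2 w), and R_b, used in the direction
   from Y to X, for mu = 2 (1 - b) / b.  The interior of the region is filled by
   convex combinations of a boundary copula and its transpose. *)
Require Import Defs.
From HB Require Import structures.
From mathcomp Require Import all_boot all_order all_algebra.
From mathcomp Require Import all_classical all_reals all_analysis.
From mathcomp Require Import measurable_realfun ring lra.
Set Implicit Arguments.
Unset Strict Implicit.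
Unset Printing Implicit Defensive.
Import Order.TTheory GRing.Theory Num.Theory.
Import numFieldNormedType.Exports.
Local Open Scope classical_set_scope.
Local Open Scope ring_scope.

(** * Dual potentials *)

Section slack.
Context {R : realType}.
Implicit Types (a b w x y : R).

(** The multiplier sweeps the boundary: [muA w] falls from 2 at [w = 1/2] to 1/2 at [w = 1], [muB b]
    takes the values above 2, and the two formulas agree at [w = b = 1/2], where the families meet.
    The endpoint -1 would need an infinite multiplier; it is treated apart, by minimizing E[X^2 Y]
    alone, which yields W. With nu(C^T) prescribed, the multiplier term is a constant, so a
    Lagrangian bound is already the sharp constrained bound, with its uniqueness. [Lambda] is the
    map from nu(C^T) to nu(C) along the boundary copulas, and [Upsilon] is the half-difference of
    these two numbers as a function of their half-sum. Both are therefore handled through the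
    parameters [w] and [b], where all identities are rational and monotonicity is checked factor by
    factor, without derivatives. *)

Definition cost (al be x y : R) : R := al * (x ^+ 2 * y) + be * (x * y ^+ 2).

(* The multiplier forced by the double contact of slackA at (1 - w, 0) and
   (1 - w, w); potA is a primitive of the y-derivative of the cost along the graph
   of T_w. *)
Definition muA w : R := (3 - 2 * w) / (2 * w).

Definition potA_lo w y : R :=
  y ^+ 3 / 3 + (1 - w) * y ^+ 2 + (1 - w) ^+ 2 * y
  - muA w * (2 * y ^+ 3 / 3 + (1 - w) * y ^+ 2).

Definition potA_hi w y : R :=
  y - y ^+ 2 + y ^+ 3 / 3 - muA w * (y ^+ 2 - 2 * y ^+ 3 / 3).

Definition potA w y : R :=
  if y <= w then potA_lo w y else potA_lo w w + potA_hi w y - potA_hi w w.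

Definition slackA w x y : R :=
  (potA w y - cost 1 (- muA w) x y)
  - (potA w (T_map w x) - cost 1 (- muA w) x (T_map w x)).

Lemma potA_hiE w y : w <= y -> potA w y = potA_lo w w + potA_hi w y - potA_hi w w.
Proof.
rewrite /potA; case: ifPn => // yw wy.
have -> : y = w by apply/eqP; rewrite eq_le yw wy.
by rewrite addrK.
Qed.

Lemma potA_loE w y : y <= w -> potA w y = potA_lo w y.
Proof. by rewrite /potA => ->. Qed.

(** The excluded lines carry genuine extra zeros: on x = 1 - w the slack vanishes at y = 0 as well
    as at y = w, and for w = 1/2 it vanishes on the whole segment y = w, x >= 1 - w. The coefficient
    2 w - 1 in [lo1] is what confines this family to w >= 1/2. *)
Lemma slackA_ge0 w x y : 1 / 2 <= w <= 1 -> 0 <= x <= 1 -> 0 <= y <= 1 ->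
  0 <= slackA w x y /\
  (x != 1 - w -> y != w -> slackA w x y = 0 -> y = T_map w x).
Proof.
move=> /andP[w2 w1] /andP[x0 x1] /andP[y0 y1].
have w0 : 0 < w by lra.
have wn0 : w != 0 by rewrite gt_eqF.
have muw : muA w * w = 3 / 2 - w by rewrite /muA; field.
have mu0 : 0 < muA w by rewrite divr_gt0; lra.
have rho : (2 * muA w + 1) * w = 3 - w by rewrite mulrDl -mulrA muw; lra.
have lo1 : forall x' y', y' <= w -> 1 - w < x' <= 1 ->
    slackA w x' y' = (y' + (1 - w) - x') ^+ 2
      * ((2 * w - 1) * (x' - (1 - w)) + 2 * (1 - w) * (w - y')) / (2 * w).
  move=> x' y' y'w /andP[ax' x'1].
  rewrite /slackA /T_map leNgt ax' /= !potA_loE //; last lra.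
  by rewrite /potA_lo /cost /muA; field.
have pos1 : forall x' y', y' <= w -> 1 - w < x' ->
    0 <= (2 * w - 1) * (x' - (1 - w)) + 2 * (1 - w) * (w - y').
  by move=> x' y' *; apply: addr_ge0; apply: mulr_ge0; lra.
have [xa|ax] := leP x (1 - w); last first.
  have [yw|wy] := leP y w.
    rewrite lo1 ?ax ?x1 //; split.
      by apply: divr_ge0; [apply: mulr_ge0; [exact: sqr_ge0|exact: pos1]|lra].
    move=> _ ynw; rewrite /T_map leNgt ax /= => /eqP.
    have yw' : y < w by rewrite lt_neqAle ynw.
    have L0 : 0 < (2 * w - 1) * (x - (1 - w)) + 2 * (1 - w) * (w - y).
      (* The two summands degenerate at opposite ends, w = 1/2 and w = 1; any cut strictly between
         leaves one of them positive on each side. *)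
      have [w34|w34] := leP w (3 / 4).
        apply: ltr_wpDl; first by apply: mulr_ge0; lra.
        by apply: mulr_gt0; lra.
      apply: ltr_pwDl; first by apply: mulr_gt0; lra.
      by apply: mulr_ge0; lra.
    rewrite mulf_eq0 invr_eq0 mulf_eq0 (gt_eqF L0) expf_eq0 /= !orbF.
    rewrite mulf_eq0 (negbTE wn0) orbF pnatr_eq0 orbF => /eqP; lra.
  (* Exact cubic expansion in y about w: its value at y = w falls under [lo1], and the other
     coefficients are nonnegative. *)
  have -> : slackA w x y = slackA w x w
      + ((x - (1 - w)) * (w - (x - (1 - w)) + (1 - w)) * (y - w)
      + ((w - (x - (1 - w)) + (1 - w)) + (2 * muA w + 1) * (x - (1 - w))) * (y - w) ^+ 2 / 2
      + (2 * muA w + 1) * (y - w) ^+ 3 / 3).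
    rewrite /slackA [potA w y]potA_hiE ?(ltW wy) // [potA w w]potA_loE // /potA_hi /cost /muA.
    by field.
  have xw0 : 0 <= slackA w x w.
    rewrite lo1 ?ax //; apply: divr_ge0; last lra.
    by apply: mulr_ge0; [exact: sqr_ge0|exact: pos1].
  have t1 : 0 <= (x - (1 - w)) * (w - (x - (1 - w)) + (1 - w)) * (y - w).
    by apply: mulr_ge0; [apply: mulr_ge0|]; lra.
  have t2 : 0 <= ((w - (x - (1 - w)) + (1 - w)) + (2 * muA w + 1) * (x - (1 - w)))
      * (y - w) ^+ 2 / 2.
    apply: divr_ge0; last lra.
    apply: mulr_ge0; last exact: sqr_ge0.
    by apply: addr_ge0; [lra|apply: mulr_ge0; lra].
  have t3 : 0 < (2 * muA w + 1) * (y - w) ^+ 3 / 3.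
    by apply: divr_gt0; [apply: mulr_gt0; [lra|apply: exprn_gt0; lra]|lra].
  by split; lra.
have [wy|yw] := leP w y.
  have E : slackA w x y = (y - (1 - x)) ^+ 2 / 6
      * ((2 * muA w + 1) * (1 - x + 2 * y) - 3 * (1 + x)).
    rewrite /slackA /T_map xa [potA w y]potA_hiE // potA_hiE; last lra.
    by rewrite /potA_hi /cost; field.
  (* Both 1 - x and y are at least w, so 1 - x + 2 y >= 3 w, and [rho] evaluates (2 mu + 1) 3 w as 9
     - 3 w. *)
  have L0 : 0 < (2 * muA w + 1) * (1 - x + 2 * y) - 3 * (1 + x).
    have : (2 * muA w + 1) * (3 * w) <= (2 * muA w + 1) * (1 - x + 2 * y).
      by apply: ler_wpM2l; lra.
    lra.
  rewrite E; split.
    by apply: mulr_ge0 (ltW L0); apply: divr_ge0; [exact: sqr_ge0|lra].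
  move=> _ _ /eqP; rewrite /T_map xa.
  rewrite mulf_eq0 (gt_eqF L0) orbF mulf_eq0 invr_eq0 pnatr_eq0 orbF.
  by rewrite expf_eq0 /= => /eqP; lra.
(* Expansion in 1 - w - x. The constant term is the slack on x = 1 - w, with its two contacts y = 0
   and y = w; the cubic term gives strictness off that line. *)
have -> : slackA w x y = y ^+ 2 * (1 - w) * (w - y) / w
    + ((w - y) * ((w - 1 / 2) + muA w * y) * (1 - w - x)
    + ((w - 1 / 2) + muA w * y + (muA w + 2) * (w - y)) * (1 - w - x) ^+ 2 / 2
    + (muA w + 2) * (1 - w - x) ^+ 3 / 3).
  rewrite /slackA /T_map xa [potA w y]potA_loE ?(ltW yw) // potA_hiE; last lra.
  by rewrite /potA_hi /potA_lo /cost /muA; field.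
have muy : 0 <= muA w * y by apply: mulr_ge0; lra.
have t0 : 0 <= y ^+ 2 * (1 - w) * (w - y) / w.
  apply: divr_ge0 (ltW w0); apply: mulr_ge0; last lra.
  by apply: mulr_ge0; [exact: sqr_ge0|lra].
have t1 : 0 <= (w - y) * ((w - 1 / 2) + muA w * y) * (1 - w - x).
  by apply: mulr_ge0; [apply: mulr_ge0|]; lra.
have t2 : 0 <= ((w - 1 / 2) + muA w * y + (muA w + 2) * (w - y)) * (1 - w - x) ^+ 2 / 2.
  apply: divr_ge0; last lra.
  apply: mulr_ge0; last exact: sqr_ge0.
  by apply: addr_ge0; [lra|apply: mulr_ge0; lra].
split.
  have : 0 <= (muA w + 2) * (1 - w - x) ^+ 3 / 3.
    by apply: divr_ge0; [apply: mulr_ge0; [lra|apply: exprn_ge0; lra]|lra].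
  lra.
move=> xna _.
have xa' : x < 1 - w by rewrite lt_neqAle xna.
have : 0 < (muA w + 2) * (1 - w - x) ^+ 3 / 3.
  by apply: divr_gt0; [apply: mulr_gt0; [lra|apply: exprn_gt0; lra]|lra].
lra.
Qed.

(* Over x > 1 - b the graph of R_b has two branches, at heights y1 and y2, and
   muB is the multiplier for which mu (y1 + y2) = 2 x.  The x-derivative of slackB
   is then mu (y - y1) (y - y2), so slackB is unimodal in x with minimum at R_b y. *)
Definition muB b : R := 2 * (1 - b) / b.

Definition potB_lo b x : R :=
  x ^+ 2 - 2 * x ^+ 3 / 3 + muB b * (1 - x) ^+ 3 / 3.

(** A primitive of mu y1 y2. Because mu (y1 + y2) = 2 x, the x-derivative 2 x y - mu y^2 of the cost
    takes this one value at both branches, so a single potential can touch both. *)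
Definition potB_hi b x : R :=
  (x ^+ 3 / 3 - (1 - b) * x ^+ 2 / 2) / (1 - b)
  - (x - (1 - b)) ^+ 3 / (6 * b * (1 - b)).

Definition potB b x : R :=
  if x <= 1 - b then potB_lo b x
  else potB_lo b (1 - b) + potB_hi b x - potB_hi b (1 - b).

Definition slackB b x y : R :=
  (potB b x - cost 1 (- muB b) x y)
  - (potB b (R_map b y) - cost 1 (- muB b) (R_map b y) y).

Lemma potB_hiE b x : 1 - b <= x ->
  potB b x = potB_lo b (1 - b) + potB_hi b x - potB_hi b (1 - b).
Proof.
rewrite /potB; case: ifPn => // yw wy.
have -> : x = 1 - b by apply/eqP; rewrite eq_le yw wy.
by rewrite addrK.
Qed.

Lemma potB_loE b x : x <= 1 - b -> potB b x = potB_lo b x.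
Proof. by rewrite /potB => ->. Qed.

Lemma z_param_lt b : 0 < b < 1 / 2 -> 0 < z_param b < b.
Proof.
move=> /andP[b0 b2]; have s0 : 0 < 2 * (1 - b) by lra.
rewrite /z_param divr_gt0 //= ltr_pdivrMr //.
by rewrite ltr_pMr //; lra.
Qed.

(** Where [potB] and [R_map] use matching pieces, the slack is (x - R_b y)^2 times a factor affine
    in x, and only that factor needs a sign. In the two mismatched regions it exceeds its value on x
    = 1 - b, which is already known to be nonnegative. *)
Lemma slackB_ge0 b x y : 0 < b < 1 / 2 -> 0 <= x <= 1 -> 0 <= y <= 1 ->
  0 <= slackB b x y /\
  (x != 1 - b -> y != z_param b -> slackB b x y = 0 -> x = R_map b y).
Proof.
move=> bI /andP[x0 x1] /andP[y0 y1].
have /andP[z0 zb] := z_param_lt bI.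
have /andP[b0 b2] := bI.
have bn0 : b != 0 by rewrite gt_eqF.
have s0 : 0 < 1 - b by lra.
have sn0 : 1 - b != 0 by rewrite gt_eqF.
have tn0 : 1 - 2 * b != 0 by rewrite gt_eqF//; lra.
have mub : muB b * b = 2 * (1 - b) by rewrite /muB; field.
have mu0 : 0 < muB b by rewrite divr_gt0; lra.
have mu2b : (muB b + 2) * b = 2 by rewrite mulrDl mub; lra.
have yzE : (y <= z_param b) = (2 * (1 - b) * y <= b).
  by rewrite /z_param ler_pdivlMr ?[y * _]mulrC //; lra.
have ynzE : y != z_param b -> y <= z_param b -> 2 * (1 - b) * y < b.
  move=> yn yz; have : y < z_param b by rewrite lt_neqAle yn.
  by rewrite /z_param ltr_pdivlMr ?[y * _]mulrC //; lra.
have [yb|by_] := leP y b; last first.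
  have Rb : R_map b y = 1 - y by rewrite /R_map !leNgt by_ (lt_trans zb by_).
  have lo1 : forall x', x' <= 1 - b -> slackB b x' y =
      (x' - (1 - y)) ^+ 2 * ((muB b + 1) * y - 1 - (muB b + 2) * (x' - (1 - y)) / 3).
    move=> x' x's; rewrite /slackB Rb !potB_loE //; last lra.
    by rewrite /potB_lo /cost; field.
  have L0 : forall x', x' <= 1 - b ->
      0 < (muB b + 1) * y - 1 - (muB b + 2) * (x' - (1 - y)) / 3.
    move=> x' x's.
    have h1 : (muB b + 2) * (x' - (1 - y)) <= (muB b + 2) * (y - b).
      by apply: ler_wpM2l; lra.
    have h2 : (2 * muB b + 1) * b <= (2 * muB b + 1) * y by apply: ler_wpM2l; lra.
    lra.
  have [xs|sx] := leP x (1 - b).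
    rewrite lo1 //; split.
      by apply: mulr_ge0; [exact: sqr_ge0|exact/ltW/L0].
    move=> _ _ /eqP; rewrite mulf_eq0 (gt_eqF (L0 _ xs)) orbF expf_eq0 /= Rb.
    by move=> /eqP; lra.
  have -> : slackB b x y = slackB b (1 - b) y + muB b *
      ((y - b) * ((x - (1 - b)) * (y - (x - (1 - b)) / (4 * (1 - b))))
      + (1 - 2 * b) * (x - (1 - b)) ^+ 2 / (4 * (1 - b))
        * (y - (x - (1 - b)) / (3 * (1 - b)))).
    rewrite /slackB [potB b x]potB_hiE ?(ltW sx) // [potB b (1 - b)]potB_loE //.
    by rewrite /potB_hi /cost /muB; field; rewrite sn0 bn0.
  have ss0 : 0 <= slackB b (1 - b) y.
    by rewrite lo1 //; apply: mulr_ge0; [exact: sqr_ge0|exact/ltW/L0].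
  have h1 : 0 <= y - (x - (1 - b)) / (4 * (1 - b)).
    rewrite subr_ge0 ler_pdivrMr; last lra.
    have : y * 2 <= y * (4 * (1 - b)) by apply: ler_wpM2l; lra.
    lra.
  have h2 : 0 < y - (x - (1 - b)) / (3 * (1 - b)).
    rewrite subr_gt0 ltr_pdivrMr; last lra.
    have : y * (3 / 2) <= y * (3 * (1 - b)) by apply: ler_wpM2l; lra.
    lra.
  have t1 : 0 <= (y - b) * ((x - (1 - b)) * (y - (x - (1 - b)) / (4 * (1 - b)))).
    by apply: mulr_ge0; [lra|apply: mulr_ge0; lra].
  have t2 : 0 < (1 - 2 * b) * (x - (1 - b)) ^+ 2 / (4 * (1 - b))
        * (y - (x - (1 - b)) / (3 * (1 - b))).
    apply: mulr_gt0 => //; apply: divr_gt0; last lra.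
    by apply: mulr_gt0; [lra|apply: exprn_gt0; lra].
  have t3 : 0 < muB b *
      ((y - b) * ((x - (1 - b)) * (y - (x - (1 - b)) / (4 * (1 - b))))
      + (1 - 2 * b) * (x - (1 - b)) ^+ 2 / (4 * (1 - b))
        * (y - (x - (1 - b)) / (3 * (1 - b)))).
    by apply: mulr_gt0; lra.
  split; lra.
have hi : forall x', 1 - b <= x' <= 1 ->
    0 <= slackB b x' y /\ (y != z_param b -> slackB b x' y = 0 -> x' = R_map b y).
  move=> x' /andP[sx' x'1]; have [yz|zy] := leP y (z_param b).
    have RE : R_map b y = 2 * (1 - b) * y + 1 - b by rewrite /R_map yz.
    have -> : slackB b x' y = muB b / (2 * (1 - b)) * (x' - (2 * (1 - b) * y + 1 - b)) ^+ 2
       * ((b - 2 * (1 - b) * y) / 2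
          - (x' - (2 * (1 - b) * y + 1 - b)) * (1 - 2 * b) / (6 * (1 - b))).
      rewrite /slackB RE !potB_hiE //; last first.
        have : 0 <= 2 * (1 - b) * y by apply: mulr_ge0; lra.
        lra.
      by rewrite /potB_hi /cost /muB; field; rewrite sn0 bn0.
    have c0 : 0 < muB b / (2 * (1 - b)) by apply: divr_gt0; lra.
    (* Here b - 2 (1 - b) y is 1 - R_b y, which bounds x' - R_b y because x' <= 1. *)
    have h1 : (x' - (2 * (1 - b) * y + 1 - b)) * (1 - 2 * b) / (6 * (1 - b))
       <= (b - 2 * (1 - b) * y) / 6.
      rewrite ler_pdivrMr; last lra.
      rewrite yzE in yz.
      have e1 : (x' - (2 * (1 - b) * y + 1 - b)) * (1 - 2 * b)
         <= (b - 2 * (1 - b) * y) * (1 - 2 * b) by apply: ler_wpM2r; lra.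
      have e2 : (b - 2 * (1 - b) * y) * (1 - 2 * b)
         <= (b - 2 * (1 - b) * y) * (1 - b) by apply: ler_wpM2l; lra.
      lra.
    split.
      apply: mulr_ge0; first by apply: mulr_ge0 (ltW c0) (sqr_ge0 _).
      rewrite yzE in yz; lra.
    move=> yn; have := ynzE yn yz => yz' /eqP.
    rewrite mulf_eq0 mulf_eq0 (gt_eqF c0) /= expf_eq0 /= RE => /orP[/eqP|/eqP]; lra.
  have RE : R_map b y = (1 - b) * (1 - 2 * y) / (1 - 2 * b).
    by rewrite /R_map leNgt zy yb.
  have -> : slackB b x' y = muB b * (1 - 2 * b) / (2 * (1 - b))
     * (x' - (1 - b) * (1 - 2 * y) / (1 - 2 * b)) ^+ 2
     * ((2 * (1 - b) * y - b) / (1 - 2 * b) / 2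
        - (x' - (1 - b) * (1 - 2 * y) / (1 - 2 * b)) / (6 * (1 - b))).
    rewrite /slackB RE !potB_hiE //; last first.
      rewrite ler_pdivlMr; last lra.
      by apply: ler_wpM2l; lra.
    by rewrite /potB_hi /cost /muB; field; rewrite sn0 bn0 tn0.
  have c0 : 0 < muB b * (1 - 2 * b) / (2 * (1 - b)).
    by apply: divr_gt0; [apply: mulr_gt0|]; lra.
  (* On this branch too, [m] equals 1 - R_b y and bounds x' - R_b y. *)
  set m := (2 * (1 - b) * y - b) / (1 - 2 * b).
  have m0 : 0 < m by rewrite divr_gt0; lra.
  have h1 : 0 < m / 2 - (x' - (1 - b) * (1 - 2 * y) / (1 - 2 * b)) / (6 * (1 - b)).
    rewrite subr_gt0 ltr_pdivrMr; last lra.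
    have e0 : 1 - (1 - b) * (1 - 2 * y) / (1 - 2 * b) = m by rewrite /m; field.
    have : m * (1 / 2) <= m * (1 - b) by apply: ler_wpM2l; lra.
    lra.
  split; first by apply: mulr_ge0 (ltW h1); apply: mulr_ge0 (ltW c0) (sqr_ge0 _).
  move=> _ /eqP.
  by rewrite mulf_eq0 (gt_eqF h1) orbF mulf_eq0 (gt_eqF c0) /= expf_eq0 /= RE => /eqP; lra.
have [sx|xs] := leP (1 - b) x.
  by have [] := hi x; rewrite ?sx ?x1 //; split => // _.
have -> : slackB b x y = slackB b (1 - b) y +
    ((b - y) * (muB b * y) * (1 - b - x)
     + (muB b * y + (muB b + 2) * (b - y)) * (1 - b - x) ^+ 2 / 2
     + (muB b + 2) * (1 - b - x) ^+ 3 / 3).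
  rewrite /slackB [potB b x]potB_loE ?(ltW xs) // [potB b (1 - b)]potB_loE // /potB_lo /cost /muB.
  by field.
have [|ss0 _] := hi (1 - b); first lra.
have muy : 0 <= muB b * y by apply: mulr_ge0; lra.
have t1 : 0 <= (b - y) * (muB b * y) * (1 - b - x).
  by apply: mulr_ge0; [apply: mulr_ge0|]; lra.
have t2 : 0 <= (muB b * y + (muB b + 2) * (b - y)) * (1 - b - x) ^+ 2 / 2.
  apply: divr_ge0; last lra.
  apply: mulr_ge0; last exact: sqr_ge0.
  by apply: addr_ge0; [lra|apply: mulr_ge0; lra].
have t3 : 0 < (muB b + 2) * (1 - b - x) ^+ 3 / 3.
  by apply: divr_gt0; [apply: mulr_gt0; [lra|apply: exprn_gt0; lra]|lra].
split; lra.
Qed.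

(** The potential for the cost -x^2 y: a primitive of -(1 - y)^2, the y-derivative of that cost
    along x = 1 - y. *)
Definition potW y : R := (1 - y) ^+ 3 / 3.

Lemma slackW_ge0 x y : 0 <= x <= 1 -> 0 <= y <= 1 ->
  let s := (potW y - cost (-1) 0 x y) - (potW (1 - x) - cost (-1) 0 x (1 - x)) in
  0 <= s /\ (x != 0 -> s = 0 -> y = 1 - x).
Proof.
move=> /andP[x0 x1] /andP[y0 y1] /=.
have -> : (potW y - cost (-1) 0 x y) - (potW (1 - x) - cost (-1) 0 x (1 - x))
  = (1 - y - x) ^+ 2 * (1 - y + 2 * x) / 3 by rewrite /potW /cost; field.
split; first by apply: divr_ge0; [apply: mulr_ge0; [exact: sqr_ge0|]|]; lra.
move=> xn0; have xp : 0 < x by rewrite lt_neqAle eq_sym xn0.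
have L : 0 < 1 - y + 2 * x by lra.
move=> /eqP; rewrite mulf_eq0 mulf_eq0 (gt_eqF L) invr_eq0 pnatr_eq0 !orbF.
by rewrite expf_eq0 /= => /eqP; lra.
Qed.

End slack.

(** * Uniform random variables *)

Section uniform_variables.
Context {R : realType}.
Local Notation mu := (@lebesgue_measure R).

(** Agreement with [p] is asked only on the open interval, so the values of piecewise maps at their
    breakpoints never matter. *)
Lemma integral_itv_poly (a b : R) (f : R -> R) (p q : {poly R}) :
  a <= b -> q^`() = p -> {in `]a, b[, forall x, f x = p.[x]} ->
  measurable_fun `[a, b] f ->
  (\int[mu]_(x in `[a, b]) (f x)%:E)%E = (q.[b] - q.[a])%:E.
Proof.
move=> ab qp fp mf; move: ab; rewrite le_eqVlt => /predU1P[<-|ab].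
  by rewrite set_itv1 integral_set1 subrr.
have E : (\int[mu]_(x in `[a, b]) (f x)%:E = \int[mu]_(x in `]a, b[) (f x)%:E)%E.
  rewrite integral_itv_bndoo//.
  by apply/measurable_EFinP; apply: measurable_funS mf => //; exact: subset_itv_oo_cc.
have mp : measurable_fun `]a, b[ (horner p).
  apply/measurable_funTS; apply: continuous_measurable_fun.
  exact/continuous_horner.
rewrite E; transitivity (\int[mu]_(x in `]a, b[) (p.[x])%:E)%E.
  by apply: eq_integral => x; rewrite inE /= => /fp ->.
rewrite -(@integral_itv_bndoo _ a b (fun x => (p.[x])%:E) true false); last exact/measurable_EFinP.
rewrite (@continuous_FTC2 _ _ (horner q)) ?EFinB//.
- apply: continuous_subspaceT => x; exact: continuous_horner.
- split.
  + by move=> x _; exact: derivable_horner.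
  + by apply: cvg_at_right_filter; exact: continuous_horner.
  + by apply: cvg_at_left_filter; exact: continuous_horner.
- by move=> x _; rewrite -derivE qp.
Qed.


Lemma unif01E (A : set (measurableTypeR R)) : measurable A ->
  unif01 A = mu (A `&` `[0, 1]).
Proof.
move=> mA; rewrite -[LHS]/(\int[mu]_(x in A) (uniform_pdf (0 : R) 1 x)%:E)%E.
rewrite integral_uniform_pdf.
have mA1 : measurable (A `&` `[0, 1]) by apply: measurableI.
rewrite -[RHS]mul1e -integral_cst//; apply: eq_integral => x.
rewrite inE /= => -[_]; rewrite in_itv /= /uniform_pdf => ->.
by rewrite subr0 invr1.
Qed.

Lemma unif01_itv (a b : R) (s t : bool) : 0 <= a -> a <= b -> b <= 1 ->
  @unif01 R [set` Interval (BSide s a) (BSide t b)] = (b - a)%:E.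
Proof.
move=> a0 ab b1; rewrite unif01E// setIidl.
  rewrite lebesgue_measure_itv /= lte_fin -EFinB.
  by case: ltgtP ab => // -> _; rewrite subrr.
by apply: subset_itv; [case: s|case: t]; rewrite bnd_simp.
Qed.

Lemma unif01_01 : @unif01 R `[0, 1]%classic = 1%E.
Proof. by rewrite unif01_itv// ?subr0// ler01. Qed.

Definition uniform_rv d (T : measurableType d) (P : probability T R) (X : T -> R) :=
  measurable_fun setT X /\
  forall A : set (measurableTypeR R), measurable A -> P (X @^-1` A) = unif01 A.

(** Two laws that agree on the rays ]r, +oo[ agree on all Borel sets, since these rays generate
    them, are stable under intersection and exhaust the line. [cdfE] first extends the hypothesis
    from levels in [0, 1] to all levels by monotonicity. *)
Lemma unif01_cdf_rv (F : measurableTypeR R -> R) : measurable_fun setT F ->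
  (forall y, 0 <= y <= 1 -> @unif01 R [set x | F x <= y] = y%:E) ->
  uniform_rv unif01 F.
Proof.
move=> mF Fy; split => //.
have mF' : @measurable_fun _ _ (measurableTypeR R) (measurableTypeR R) setT F := mF.
pose F' : {mfun (measurableTypeR R) >-> (measurableTypeR R)} :=
  HB.pack (F : measurableTypeR R -> measurableTypeR R) (isMeasurableFun.Build _ _ _ _ _ mF').
have mFr r : measurable [set x | F x <= r].
  rewrite -[X in measurable X]setTI.
  exact: (measurable_fun_ler mF (measurable_cst r)).
have cdfE r : @unif01 R [set x | F x <= r] = unif01 `]-oo, r]%classic.
  rewrite [RHS]unif01E//.
  have [r0|r0] := ltP r 0.
    rewrite [X in mu X](_ : _ = set0); last first.
      apply/seteqP; split => x //=; rewrite !in_itv /= => -[xr /andP[x0 _]]; lra.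
    rewrite measure0; apply/eqP; rewrite -measure_le0.
    have <- : @unif01 R [set x | F x <= 0] = 0%E by rewrite Fy ?lexx ?ler01.
    apply: le_measure; rewrite ?inE//.
    by move=> x /=; lra.
  have [r1|r1] := leP r 1.
    rewrite Fy ?r0// [X in mu X](_ : _ = `[0, r]%classic); last first.
      by apply/seteqP; split => x /=; rewrite !in_itv /=; [case|]; lra.
    rewrite lebesgue_measure_itv /= lte_fin -EFinB subr0.
    by move: r0; rewrite le_eqVlt => /predU1P[<-|->//]; rewrite ltxx.
  rewrite [X in mu X](_ : _ = `[0, 1]%classic); last first.
    by apply/seteqP; split => x /=; rewrite !in_itv /=; [case|]; lra.
  rewrite lebesgue_measure_itv /= lte_fin ltr01 -EFinB subr0.
  apply/eqP; rewrite eq_le probability_le1//=.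
  have <- : @unif01 R [set x | F x <= 1] = 1%E by rewrite Fy ?lexx ?ler01.
  apply: le_measure; rewrite ?inE//.
  by move=> x /=; lra.
move=> A mA; rewrite -[LHS]/(distribution unif01 F' A).
apply: (@measure_unique _ R (measurableTypeR R) (@RGenOInfty.G R)
  (fun n => `](- n%:R), +oo[%classic) _ _ _ _
  (distribution unif01 F') unif01) => //.
- exact: RGenOInfty.measurableE.
- move=> _ _ [x ->] [y ->]; exists (Num.max x y).
  apply/seteqP; split => z /=; rewrite !in_itv /= !andbT gt_max.
    by move=> [-> ->].
  by move=> /andP.
- by move=> n; eexists; reflexivity.
- apply/seteqP; split => // x _; exists (Num.truncn `|x|).+1 => //=.
  rewrite in_itv /= andbT ltrNl (le_lt_trans _ (truncnS_gt _))//.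
  by rewrite -normrN ler_norm.
- move=> _ [r ->]; rewrite /distribution /pushforward.
  rewrite [LHS](_ : _ = @unif01 R (~` [set x | F x <= r])); last first.
    congr (unif01 _); apply/seteqP; split => x /=; rewrite in_itv /= andbT ltNge.
      by move/negP.
    by move/negP.
  rewrite -setCitvl; transitivity (1 - @unif01 R [set x | (F x <= r)%R])%E.
    exact: probability_setC.
  by rewrite cdfE; apply/esym; exact: probability_setC.
- by move=> k; rewrite (le_lt_trans (probability_le1 _ _))// ltry.
Qed.


Lemma uniform_rv_ae d (T : measurableType d) (P : probability T R) (X : T -> R) :
  uniform_rv P X -> {ae P, forall t, 0 <= X t <= 1}.
Proof.
move=> [mX PX].
have m01 : measurable (~` `[0, 1]%classic : set (measurableTypeR R)).
  exact: measurableC.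
exists (X @^-1` (~` `[0, 1]%classic)); split.
- by rewrite -[X in measurable X]setTI; exact: mX.
- rewrite PX//; transitivity (1 - @unif01 R `[0%R, 1%R]%classic)%E.
    exact: probability_setC.
  by rewrite unif01_01 subee.
- by move=> t /= /negP; rewrite in_itv /= => /negP.
Qed.

Lemma uniform_rv_neq d (T : measurableType d) (P : probability T R) (X : T -> R) (a : R) :
  uniform_rv P X -> {ae P, forall t, X t != a}.
Proof.
move=> [mX PX]; have ma : measurable ([set a] : set (measurableTypeR R)).
  exact: measurable_set1.
exists (X @^-1` [set a]); split.
- by rewrite -[X in measurable X]setTI; exact: mX.
- rewrite PX// unif01E//; apply/eqP; rewrite -measure_le0.
  rewrite -(lebesgue_measure_set1 a); apply: le_measure; rewrite ?inE//.
  exact: measurableI.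
- by move=> t /= /negP; rewrite negbK => /eqP.
Qed.

Lemma ae_bounded_integrable d (T : measurableType d) (P : probability T R)
    (f : T -> R) (M : R) : measurable_fun setT f ->
  {ae P, forall t, `|f t| <= M} -> P.-integrable setT (EFin \o f).
Proof.
move=> mf fM; apply/integrableP; split; first exact/measurable_EFinP.
apply: le_lt_trans.
  apply: (integral_le_bound (`|M|)%:E) => //; first exact/measurable_EFinP.
  by apply: filterS fM => t ft _; rewrite lee_fin (le_trans ft)// ler_norm.
rewrite lte_mul_pinfty ?lee_fin//.
by apply: (le_lt_trans (probability_le1 P measurableT)); rewrite ltry.
Qed.

Lemma uniform_rv_comp d (T : measurableType d) (P : probability T R) (X : T -> R)
    (F : measurableTypeR R -> R) :
  uniform_rv P X -> uniform_rv unif01 F -> uniform_rv P (F \o X).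
Proof.
move=> [mX PX] [mF UF]; split.
  by apply: (@measurableT_comp _ _ _ _ R R F) => //; exact: mF.
move=> A mA; rewrite -UF// -PX//.
by rewrite -[X in measurable X]setTI; exact: mF.
Qed.

Lemma uniform_rv_integral d (T : measurableType d) (P : probability T R) (X : T -> R)
    (g : measurableTypeR R -> R) (M : R) :
  uniform_rv P X -> measurable_fun setT g -> (forall x, 0 <= x <= 1 -> `|g x| <= M) ->
  \int[P]_t g (X t) = \int[unif01]_x g x.
Proof.
move=> uX mg gM; have [mX PX] := uX.
have mX' : @measurable_fun _ _ T (measurableTypeR R) setT X := mX.
rewrite /Rintegral; congr fine.
transitivity (\int[pushforward P (X : T -> measurableTypeR R)]_x (g x)%:E)%E.
  rewrite (@integral_pushforward _ _ _ _ _ _ mX' P setT (EFin \o g))//.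
  - exact/measurable_EFinP.
  - rewrite preimage_setT.
    apply: (@ae_bounded_integrable _ _ _ (g \o X) M).
      by apply: (@measurableT_comp _ _ _ _ R R g) => //; exact: mg.
    by apply: filterS (uniform_rv_ae uX) => t; exact: gM.
apply: (eq_measure_integral (@unif01 R)) => A mA _.
exact: PX.
Qed.

Lemma uniform_rv_id : uniform_rv (@unif01 R) idfun.
Proof. by split => //; exact: (@measurable_id _ (measurableTypeR R)). Qed.

(** [integral_uniform] asks for an integrand that is nonnegative everywhere; hence the truncation
    [g'], which differs from [g] only on a null set of the uniform law. *)
Lemma integral_unif01_ge0 (g : measurableTypeR R -> R) :
  measurable_fun setT g -> (forall x, 0 <= x <= 1 -> 0 <= g x) ->
  (\int[unif01]_x (g x)%:E = \int[mu]_(x in `[0%R, 1%R]) (g x)%:E)%E.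
Proof.
move=> mg g0; pose g' := g \_ `[0, 1]%classic.
have mg' : measurable_fun setT (g' : measurableTypeR R -> R).
  apply: (proj1 (@measurable_restrictT _ _ (measurableTypeR R) _ _ g (measurable_itv _))).
  exact: measurable_funTS.
transitivity (\int[@unif01 R]_x (g' x)%:E)%E.
  apply: ae_eq_integral; [exact: measurableT|apply/measurable_EFinP; exact: mg|
    apply/measurable_EFinP; exact: mg'|].
  apply: filterS (uniform_rv_ae uniform_rv_id) => x x01 _.
  by rewrite /g' patchE mem_set//= in_itv.
rewrite integral_uniform.
- rewrite subr0 invr1 mul1e; apply: eq_integral => x x01.
  by rewrite /g' patchE x01.
- exact/measurable_EFinP.
- move=> x; rewrite lee_fin /g' patchE; case: ifPn => //.
  by rewrite inE /= in_itv => /g0.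
Qed.

End uniform_variables.

(** * Blest's rank correlation as a moment *)

Section blest_formula.
Context {R : realType}.
Local Notation mu := (@lebesgue_measure R).

(** The layer-cake exchange, in nonnegative extended-real form so that no integrability has to be
    checked. It is used twice: with [h] the indicator of the other coordinate, then with [h] the
    outcome of the first integration. *)
Lemma tonelli_layer d (T : measurableType d) (P : probability T R) (X h : T -> R)
    (phi : measurableTypeR R -> R) :
  measurable_fun setT X -> measurable_fun setT h -> measurable_fun setT phi ->
  (forall t, 0 <= h t) -> (forall u, 0 <= u <= 1 -> 0 <= phi u) ->
  (\int[mu]_(u in `[0%R, 1%R]) ((phi u)%:E * \int[P]_t (h t * (X t <= u)%R%:R)%:E) =
   \int[P]_t ((h t)%:E * \int[mu]_(u in `[0%R, 1%R]) (phi u * (X t <= u)%R%:R)%:E))%E.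
Proof.
move=> mX mh mphi h0 phi0; pose psi := phi \_ `[0, 1]%classic.
have mpsi : measurable_fun setT (psi : measurableTypeR R -> R).
  apply: (proj1 (@measurable_restrictT _ _ (measurableTypeR R) _ _ phi (measurable_itv _))).
  exact: measurable_funTS.
have psi0 u : 0 <= psi u.
  rewrite /psi patchE; case: ifPn => //.
  by rewrite inE /= in_itv => /phi0.
have mle : measurable_fun setT
    (fun z : measurableTypeR R * T => (X z.2 <= z.1)%R%:R : R).
  have -> : (fun z : measurableTypeR R * T => (X z.2 <= z.1)%R%:R : R)
     = (fun z => if X z.2 <= z.1 then 1 else 0).
    by apply/funext => z; case: (X z.2 <= z.1).
  apply: measurable_fun_ifT => //.
  apply: measurable_fun_ler.
    by apply: measurableT_comp => //; exact: measurable_snd.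
  exact: measurable_fst.
have mle1 (u : R) : measurable_fun setT (fun t => (X t <= u)%R%:R : R).
  have -> : (fun t => (X t <= u)%R%:R : R) = (fun t => if X t <= u then 1 else 0).
    by apply/funext => t; case: (X t <= u).
  by apply: measurable_fun_ifT => //; apply: measurable_fun_ler.
have mle2 (x : R) : measurable_fun setT (fun u : measurableTypeR R => (x <= u)%R%:R : R).
  have -> : (fun u : measurableTypeR R => (x <= u)%R%:R : R) = (fun t => if x <= t then 1 else 0).
    by apply/funext => t; case: (x <= t).
  by apply: measurable_fun_ifT => //; apply: measurable_fun_ler.
pose f (z : measurableTypeR R * T) : \bar R := (psi z.1 * (h z.2 * (X z.2 <= z.1)%R%:R))%:E.
have mf : measurable_fun setT f.
  apply/measurable_EFinP; apply: measurable_funM.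
    by apply: (@measurableT_comp _ _ _ _ _ _ psi) => //; exact: measurable_fst.
  by apply: measurable_funM => //; apply: measurableT_comp => //; exact: measurable_snd.
have f0 z : (0 <= f z)%E by rewrite lee_fin mulr_ge0// mulr_ge0.
transitivity (\int[mu]_u \int[P]_t f (u, t))%E.
  rewrite [LHS]integral_mkcond; apply: eq_integral => u _.
  rewrite patchE.
  under [RHS]eq_integral do rewrite /f /= EFinM.
  rewrite ge0_integralZl//; last 3 first.
  - by apply/measurable_EFinP; exact: measurable_funM.
  - by move=> t _; rewrite lee_fin mulr_ge0.
  - by rewrite lee_fin.
  by rewrite /psi patchE; case: ifPn => //; rewrite mul0e.
rewrite fubini_tonelli//; apply: eq_integral => t _.
rewrite [X in (_ * X)%E]integral_mkcond -ge0_integralZl//; last 3 first.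
- apply: (proj1 (@measurable_restrictT _ _ (measurableTypeR R) _ _
    (fun u => (phi u * (X t <= u)%R%:R)%:E) (measurable_itv _))).
  by apply/measurable_EFinP/measurable_funTS; exact: measurable_funM.
- move=> u _; rewrite patchE; case: ifPn => //.
  by rewrite inE /= in_itv => /phi0 ?; rewrite lee_fin mulr_ge0.
- by rewrite lee_fin.
apply: eq_integral => u _; rewrite /f /= patchE /psi patchE.
by case: ifPn => _; rewrite ?mul0r ?mule0// -EFinM mulrCA.
Qed.

Lemma integral_layer (phi : measurableTypeR R -> R) (p q : {poly R}) (s : R) :
  0 <= s <= 1 -> (forall u, phi u = p.[u]) -> q^`() = p ->
  (\int[mu]_(u in `[0%R, 1%R]) (phi u * (s <= u)%R%:R)%:E)%E = (q.[1] - q.[s])%:E.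
Proof.
move=> /andP[s0 s1] phip qp.
transitivity (\int[mu]_(u in `[0%R, 1%R] `&` `[s, 1%R]) (phi u)%:E)%E.
  rewrite integral_mkcondr; apply: eq_integral => u.
  rewrite inE /= in_itv /= => /andP[u0 u1]; rewrite patchE.
  case: ifPn => [|/negP]; rewrite inE /= in_itv /= u1 andbT.
    by move=> ->; rewrite mulr1.
  by move/negP/negbTE => ->; rewrite mulr0.
rewrite setIidr; last by apply: subset_itvr; rewrite bnd_simp.
apply: (@integral_itv_poly _ s 1 phi p q) => //.
apply/measurable_funTS; rewrite (_ : phi = horner p); last exact/funext.
apply: continuous_measurable_fun; exact: continuous_horner.
Qed.

(** A uniform variable may leave [0, 1] on a null set. Clamping gives a formula valid for every real
    [s], hence a measurable integrand; the clamp is removed later, almost everywhere. *)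
Lemma integral_layer_clamp (phi : measurableTypeR R -> R) (p q : {poly R}) (s : R) :
  (forall u, phi u = p.[u]) -> q^`() = p ->
  (\int[mu]_(u in `[0%R, 1%R]) (phi u * (s <= u)%R%:R)%:E)%E
  = (q.[1] - q.[Num.min (Num.max s 0) 1])%:E.
Proof.
move=> phip qp; have [s0|s0] := leP s 0.
  rewrite min_l ?ler01// -(@integral_layer phi p q 0)// ?lexx ?ler01//.
  apply: eq_integral => u; rewrite inE /= in_itv /= => /andP[u0 _].
  by rewrite u0 (le_trans s0 u0).
have [s1|s1] := leP s 1; first by apply: integral_layer => //; rewrite ltW.
rewrite subrr (_ : 0%:E = 0%E)//; apply: integral0_eq => u /=.
by rewrite in_itv /= => /andP[_ u1]; rewrite leNgt (le_lt_trans u1 s1) mulr0.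
Qed.

(** Write C(u, v) as the expectation of the product of the indicators of X <= u and Y <= v.
    Integrating 1 - u over u >= X gives (1 - X)^2 / 2, integrating 1 over v >= Y gives 1 - Y, and 24
    / 2 = 12. *)
Lemma blest_joint_cdf d (T : measurableType d) (P : probability T R) (X Y : T -> R)
    (C : R -> R -> R) :
  uniform_rv P X -> uniform_rv P Y -> eq_copula C (joint_cdf P X Y) ->
  blest C = 12 * (\int[P]_t ((1 - X t) ^+ 2 * (1 - Y t))) - 2.
Proof.
move=> uX uY CE; have [mX _] := uX; have [mY _] := uY.
have mle (Z : T -> R) (u : R) : measurable_fun setT Z ->
    measurable_fun setT (fun t => (Z t <= u)%R%:R : R).
  move=> mZ.
  have -> : (fun t => (Z t <= u)%R%:R : R) = (fun t => if Z t <= u then 1 else 0).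
    by apply/funext => t; case: (Z t <= u).
  by apply: measurable_fun_ifT => //; apply: measurable_fun_ler.
have msub (Z : T -> R) : measurable_fun setT Z -> measurable_fun setT (fun t => 1 - Z t).
  by move=> mZ; exact: measurable_funB.
have mpoly (Z : T -> R) : measurable_fun setT Z ->
    measurable_fun setT (fun t => Num.min (Num.max (Z t) 0) 1).
  by move=> mZ; apply: measurable_minr => //; exact: measurable_maxr.
have L1 s : (\int[mu]_(u in `[0%R, 1%R]) ((1 - u) * (s <= u)%R%:R)%:E)%E
    = (2^-1 - (Num.min (Num.max s 0) 1 - Num.min (Num.max s 0) 1 ^+ 2 / 2))%:E.
  rewrite (@integral_layer_clamp (fun u => 1 - u) (1 - 'X) ('X - 2^-1 *: 'X^2)).
  - by rewrite !(hornerD, hornerN, hornerZ, hornerXn, hornerX, hornerC); congr EFin; field.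
  - by move=> u; rewrite !hornerE.
  - rewrite derivB derivX derivZ derivXn /= expr1.
    by rewrite -(scaler_nat 2 'X) scalerA mulVf// scale1r.
have L0 s : (\int[mu]_(u in `[0%R, 1%R]) (1 * (s <= u)%R%:R)%:E)%E
    = (1 - Num.min (Num.max s 0) 1)%:E.
  rewrite (@integral_layer_clamp (fun=> 1) 1 'X) ?hornerE ?derivX//.
  by move=> u; rewrite hornerE.
have inner v : v \in `[0, 1] ->
   (\int[mu]_(u in `[0%R, 1%R]) ((1 - u) * C u v)%:E =
    \int[P]_t ((1 - X t) ^+ 2 / 2 * (Y t <= v)%R%:R)%:E)%E.
  move=> v01.
  transitivity (\int[mu]_(u in `[0%R, 1%R])
     ((1 - u)%:E * \int[P]_t ((Y t <= v)%R%:R * (X t <= u)%R%:R)%:E))%E.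
    apply: eq_integral => u; rewrite inE /= => u01; rewrite CE// /joint_cdf.
    have mA : measurable [set t | X t <= u /\ Y t <= v].
      rewrite [X in measurable X](_ : _ =
         [set t | (X t <= u) && (Y t <= v)]); last first.
        by apply/seteqP; split => t /=; [move=> [-> ->]|move/andP].
      rewrite -[X in measurable X]setTI.
      have := measurable_and (measurable_fun_ler mX (measurable_cst u))
                (measurable_fun_ler mY (measurable_cst v)).
      by move=> /(_ measurableT [set true]); apply.
    rewrite EFinM; congr (_ * _)%E; rewrite fineK ?fin_num_measure//.
    rewrite -[LHS]mul1e -integral_cst// integral_mkcond.
    apply: eq_integral => t _; rewrite patchE.
    case: ifPn => [|/negP]; rewrite inE /=.
      by move=> [-> ->]; rewrite mulr1.
    move=> H; have : ~~ ((X t <= u) && (Y t <= v)).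
      by apply/negP => /andP[Xu Yv]; apply: H.
    by case: (X t <= u); case: (Y t <= v) => //= _; rewrite ?mulr0 ?mul0r.
  rewrite (@tonelli_layer _ _ P X (fun t => (Y t <= v)%R%:R) (fun u => 1 - u))//.
  - under eq_integral do rewrite L1 -EFinM.
    apply: ae_eq_integral => //.
    + apply/measurable_EFinP; apply: measurable_funM; first exact: mle.
      have mX' := mpoly X mX; do 2 apply: measurable_funB => //.
      by apply: measurable_funM => //; exact: measurable_funX.
    + apply/measurable_EFinP; apply: measurable_funM; last exact: mle.
      by apply: measurable_funM => //; exact: measurable_funX (msub _ mX).
    apply: filterS (uniform_rv_ae uX) => t /andP[Xt0 Xt1] _.
    by rewrite max_l// min_l//; congr EFin; field.
  - exact: mle.
  - exact: measurable_funB.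
  - by move=> u /andP[_]; rewrite subr_ge0.
have mh : measurable_fun setT (fun t => (1 - X t) ^+ 2 / 2).
  by apply: measurable_funM => //; exact: measurable_funX (msub _ mX).
have h0 t : 0 <= (1 - X t) ^+ 2 / 2 by rewrite divr_ge0// sqr_ge0.
have hle : {ae P, forall t, (1 - X t) ^+ 2 / 2 <= 1 / 2}.
  apply: filterS (uniform_rv_ae uX) => t /andP[Xt0 Xt1].
  have : (1 - X t) ^+ 2 <= 1 by rewrite expr2 mulr_ile1//; lra.
  lra.
rewrite /blest; congr (_ - _).
rewrite {1}/Rintegral.
rewrite (_ : (\int[mu]_(v in `[0%R, 1%R])
   (\int[mu]_(u in `[0%R, 1%R]) ((1 - u) * C u v))%:E)%E =
   \int[P]_t ((1 - X t) ^+ 2 / 2 * (1 - Y t))%:E)%E; last first.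
  transitivity (\int[mu]_(v in `[0%R, 1%R])
    (1%:E * \int[P]_t ((1 - X t) ^+ 2 / 2 * (Y t <= v)%R%:R)%:E))%E.
    apply: eq_integral => v; rewrite inE /= => v01.
    rewrite mul1e /Rintegral inner// fineK//.
    apply: integrable_fin_num => //.
    apply: (@ae_bounded_integrable _ _ _ _ _ (1 / 2)).
      by apply: measurable_funM => //; exact: mle.
    apply: filterS hle => t ht; rewrite ger0_norm; last by rewrite mulr_ge0.
    by case: (Y t <= v); rewrite ?mulr1 ?mulr0.
  rewrite (@tonelli_layer _ _ P Y _ (fun=> 1))//.
  under eq_integral do rewrite L0 -EFinM.
  apply: ae_eq_integral => //.
  - apply/measurable_EFinP; apply: measurable_funM => //.
    by apply: measurable_funB => //; exact: mpoly.
  - by apply/measurable_EFinP; apply: measurable_funM => //; exact: msub.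
  apply: filterS (uniform_rv_ae uY) => t /andP[Yt0 Yt1] _.
  by rewrite max_l// min_l//.
have intb : P.-integrable setT (EFin \o (fun t => (1 - X t) ^+ 2 * (1 - Y t))).
  apply: (@ae_bounded_integrable _ _ _ _ _ 1).
    by apply: measurable_funM; [exact: measurable_funX (msub _ mX)|exact: msub].
  apply: filterS2 (uniform_rv_ae uX) (uniform_rv_ae uY) => t Xt Yt.
  rewrite ger0_norm; last by rewrite mulr_ge0 ?sqr_ge0//; lra.
  have : (1 - X t) ^+ 2 <= 1 by rewrite expr2 mulr_ile1//; lra.
  by move=> ?; rewrite mulr_ile1 ?sqr_ge0//; lra.
rewrite [X in 24 * X](_ : _ = \int[P]_t (2^-1 * ((1 - X t) ^+ 2 * (1 - Y t)))).
  by rewrite RintegralZl// mulrA; congr (_ * _); field.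
by congr fine; apply: eq_integral => t _; congr EFin; field.
Qed.
End blest_formula.

(** * Copulas and the transport bound *)

Section copulas.
Context {R : realType}.
Local Notation mR := (measurableTypeR R).
Implicit Types C D G : R -> R -> R.

Lemma eq_copula_sym C D : eq_copula C D -> eq_copula D C.
Proof. by move=> CD u v u01 v01; rewrite CD. Qed.

Lemma eq_copula_trans C D G : eq_copula C D -> eq_copula D G -> eq_copula C G.
Proof. by move=> CD DG u v u01 v01; rewrite CD// DG. Qed.

Lemma eq_copula_transpose C D : eq_copula C D -> eq_copula (transpose C) (transpose D).
Proof. by move=> CD u v u01 v01; exact: CD. Qed.

Lemma eq_is_copula C D : eq_copula C D -> is_copula D -> is_copula C.
Proof.
by move=> CD [P [P1 Pf Ps DP]]; exists P; split => // u v u01 v01; rewrite CD// DP.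
Qed.

Lemma eq_blest C D : eq_copula C D -> blest C = blest D.
Proof.
move=> CD; rewrite /blest; congr (24 * _ - 2).
apply: eq_Rintegral => v; rewrite inE /= => v01.
by apply: eq_Rintegral => u; rewrite inE /= => u01; rewrite CD.
Qed.

Lemma is_copulaP C : is_copula C ->
  exists P : probability (mR * mR)%type R,
    [/\ uniform_rv P (fst : mR * mR -> R), uniform_rv P (snd : mR * mR -> R)
      & eq_copula C (joint_cdf P fst snd)].
Proof.
move=> [P [P1 Pf Ps CP]]; by exists P; split => //; split.
Qed.

Lemma joint_cdf_copula d (T : measurableType d) (P : probability T R) (X Y : T -> R) :
  uniform_rv P X -> uniform_rv P Y -> is_copula (joint_cdf P X Y).
Proof.
move=> [mX PX] [mY PY].
have mXY : @measurable_fun _ _ T (mR * mR)%type setT (fun t => (X t, Y t)).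
  by apply/measurable_fun_pairP; split; [exact: mX|exact: mY].
pose XY : {mfun T >-> (mR * mR)%type} :=
  HB.pack ((fun t => (X t, Y t)) : T -> (mR * mR)%type)
    (isMeasurableFun.Build _ _ _ _ _ mXY).
have m01 : measurable (`[0, 1]%classic : set mR) by exact: measurable_itv.
exists (distribution P XY); split => //.
- rewrite -[LHS]/(P ((X @^-1` `[0, 1]%classic) `&` (Y @^-1` `[0, 1]%classic))).
  have mX1 : measurable (X @^-1` `[0, 1]%classic) by rewrite -[X in measurable X]setTI; exact: mX.
  have mY1 : measurable (Y @^-1` `[0, 1]%classic) by rewrite -[X in measurable X]setTI; exact: mY.
  have PC (Z : T -> R) : measurable (Z @^-1` `[0, 1]%classic) ->
      P (Z @^-1` `[0, 1]%classic) = 1%E -> P (~` (Z @^-1` `[0, 1]%classic)) = 0%E.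
    by move=> mZ PZ; rewrite probability_setC// PZ subee.
  apply/eqP; rewrite -[X in P X]setCK probability_setC; last first.
    exact/measurableC/measurableI.
  rewrite setCI; apply/eqP.
  rewrite [X in (_ - X)%E](_ : _ = 0%E) ?sube0//.
  apply/eqP; rewrite -measure_le0; apply: (le_trans (measureU2 _ _ _)); [exact: measurableC..|].
  rewrite -[leRHS]adde0; apply: leeD; rewrite le_eqVlt; apply/orP; left; apply/eqP.
    by apply: PC; rewrite ?PX ?unif01_01.
  by apply: PC; rewrite ?PY ?unif01_01.
Qed.

Lemma joint_cdfC d (T : measurableType d) (P : probability T R) (X Y : T -> R) :
  transpose (joint_cdf P X Y) = joint_cdf P Y X.
Proof.
apply/funext => u; apply/funext => v; rewrite /transpose /joint_cdf.
by congr (fine (P _)); apply/seteqP; split => t [].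
Qed.

Lemma is_copula_transpose C : is_copula C -> is_copula (transpose C).
Proof.
move=> /is_copulaP[P [u1 u2 CP]].
apply: eq_is_copula (eq_copula_transpose CP) _.
by rewrite joint_cdfC; exact: joint_cdf_copula.
Qed.

Lemma uniform_rv_onem : uniform_rv (@unif01 R) (fun x => 1 - x).
Proof.
apply: unif01_cdf_rv => [|y /andP[y0 y1]].
  by apply: measurable_funB => //; exact: (@measurable_id _ mR).
rewrite unif01E; last first.
  rewrite [X in measurable X](_ : _ = `[1 - y, +oo[%classic)//.
  by apply/seteqP; split => x; rewrite /= in_itv /= andbT; lra.
rewrite [X in lebesgue_measure X](_ : _ = `[1 - y, 1]%classic); last first.
  by apply/seteqP; split => x; rewrite /= !in_itv /=; [case|]; lra.
rewrite lebesgue_measure_itv /= lte_fin -EFinB.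
by case: ltP => ?; congr EFin; lra.
Qed.

Lemma uniform_rv_1B d (T : measurableType d) (P : probability T R) (X : T -> R) :
  uniform_rv P X -> uniform_rv P (fun t => 1 - X t).
Proof. by move=> uX; have := uniform_rv_comp uX uniform_rv_onem. Qed.

Local Opaque blest.

Lemma cost_bound al be x y : 0 <= x <= 1 -> 0 <= y <= 1 ->
  `|cost al be x y : R| <= `|al| + `|be|.
Proof.
move=> /andP[x0 x1] /andP[y0 y1]; rewrite /cost (le_trans (ler_normD _ _))//.
rewrite (normrM al) (normrM be).
rewrite (@ger0_norm _ (x ^+ 2 * y)) ?mulr_ge0 ?sqr_ge0//.
rewrite (@ger0_norm _ (x * y ^+ 2)) ?mulr_ge0 ?sqr_ge0//.
have x21 : x ^+ 2 <= 1 by rewrite expr2 mulr_ile1.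
have y21 : y ^+ 2 <= 1 by rewrite expr2 mulr_ile1.
by rewrite lerD// ler_piMr// mulr_ile1// sqr_ge0.
Qed.

Lemma measurable_cost d (T : measurableType d) (al be : R) (X Y : T -> R) :
  measurable_fun setT X -> measurable_fun setT Y ->
  measurable_fun setT (fun t => cost al be (X t) (Y t)).
Proof.
move=> mX mY; apply: measurable_funD; apply: measurable_funM => //;
  apply: measurable_funM => //; exact: measurable_funX.
Qed.

Lemma integrable_cost d (T : measurableType d) (P : probability T R) al be (X Y : T -> R) :
  uniform_rv P X -> uniform_rv P Y ->
  P.-integrable setT (EFin \o (fun t => cost al be (X t) (Y t))).
Proof.
move=> uX uY; apply: (@ae_bounded_integrable _ _ _ _ _ (`|al| + `|be|)).
  by apply: measurable_cost; [case: uX|case: uY].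
by apply: filterS2 (uniform_rv_ae uX) (uniform_rv_ae uY) => t; exact: cost_bound.
Qed.

Lemma blest_cost d (T : measurableType d) (P : probability T R) (X Y : T -> R) C al be :
  uniform_rv P X -> uniform_rv P Y ->
  eq_copula C (joint_cdf P (fun t => 1 - X t) (fun t => 1 - Y t)) ->
  al * blest C + be * blest (transpose C)
  = 12 * (\int[P]_t cost al be (X t) (Y t)) - 2 * (al + be).
Proof.
move=> uX uY CP.
have uX' := uniform_rv_1B uX; have uY' := uniform_rv_1B uY.
have E1 : blest C = 12 * (\int[P]_t cost 1 0 (X t) (Y t)) - 2.
  rewrite (blest_joint_cdf uX' uY' CP); congr (12 * _ - 2).
  by apply: eq_Rintegral => t _; rewrite /cost; ring.
have E2 : blest (transpose C) = 12 * (\int[P]_t cost 0 1 (X t) (Y t)) - 2.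
  have CP' := eq_copula_transpose CP; rewrite joint_cdfC in CP'.
  rewrite (blest_joint_cdf uY' uX' CP'); congr (12 * _ - 2).
  by apply: eq_Rintegral => t _; rewrite /cost; ring.
have E3 : \int[P]_t cost al be (X t) (Y t) =
    al * (\int[P]_t cost 1 0 (X t) (Y t)) + be * (\int[P]_t cost 0 1 (X t) (Y t)).
  have i1 := integrable_cost 1 0 uX uY; have i2 := integrable_cost 0 1 uX uY.
  rewrite -!RintegralZl// -RintegralD//.
  - by apply: eq_Rintegral => t _; rewrite /cost; ring.
  - apply: eq_integrable (integrable_cost al 0 uX uY) => // t _.
    by rewrite /= /cost; congr EFin; ring.
  - apply: eq_integrable (integrable_cost 0 be uX uY) => // t _.
    by rewrite /= /cost; congr EFin; ring.
by rewrite E1 E2 E3; ring.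
Qed.

Lemma ae_eq_probability d (T : measurableType d) (P : probability T R) (A B : set T) :
  measurable A -> measurable B -> {ae P, forall t, A t <-> B t} -> P A = P B.
Proof.
move=> mA mB AB.
have PE (E : set T) : measurable E -> P E = (\int[P]_t (\1_E t)%:E)%E.
  by move=> mE; rewrite integral_indic// setIT.
rewrite !PE//.
apply: ae_eq_integral => //; try exact/measurable_EFinP/measurable_indic.
apply: filterS AB => t AB _; rewrite !indicE.
by have -> : (t \in A) = (t \in B) by apply/idP/idP; rewrite !inE => /AB.
Qed.

(** Y and F(X) are both uniform, so g(Y) and g(F(X)) have the same mean and the expected slack is
    exactly the gap between the two expected costs. If the gap is zero, the slack, being nonnegative
    almost surely, vanishes almost surely; this forces Y = F(X) off the null lines x = x0 and y =
    y0. *)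
Lemma transport_bound (F g : mR -> R) (al be M x0 y0 : R) C :
  uniform_rv unif01 F -> (forall x, 0 <= x <= 1 -> 0 <= F x <= 1) ->
  measurable_fun setT g -> (forall x, 0 <= x <= 1 -> `|g x| <= M) ->
  (forall x y, 0 <= x <= 1 -> 0 <= y <= 1 ->
    let s := (g y - cost al be x y) - (g (F x) - cost al be x (F x)) in
    0 <= s /\ (x != x0 -> y != y0 -> s = 0 -> y = F x)) ->
  is_copula C ->
  let G := joint_cdf unif01 (fun x => 1 - x) (fun x => 1 - F x) in
  al * blest C + be * blest (transpose C)
    <= al * blest G + be * blest (transpose G) /\
  (al * blest C + be * blest (transpose C)
    = al * blest G + be * blest (transpose G) -> eq_copula C G).
Proof.
have lin (a c i j k : R) : a = 12 * i - k -> c = 12 * j - k ->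
    (i <= j -> a <= c) * (a = c -> i = j) by move=> -> ->; split=> ?; lra.
move=> uF F01 mg gM slack /is_copulaP[P [uU uV CP]] G.
set X : mR * mR -> R := fun t => 1 - t.1.
set Y : mR * mR -> R := fun t => 1 - t.2.
have uX : uniform_rv P X := uniform_rv_1B uU.
have uY : uniform_rv P Y := uniform_rv_1B uV.
have uFX := uniform_rv_comp uX uF.
have [mF _] := uF; have [mX _] := uX; have [mY _] := uY; have [mFX _] := uFX.
have CP' : eq_copula C (joint_cdf P (fun t => 1 - X t) (fun t => 1 - Y t)).
  apply: eq_copula_trans CP _ => u v _ _; rewrite /joint_cdf.
  congr (fine (P _)); rewrite /X /Y; apply/seteqP.
  by split => -[a c] /=; rewrite !opprB !(addrC 1) !subrK.
have E1 := blest_cost al be uX uY CP'.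
have E2 := @blest_cost _ _ _ (idfun : mR -> R) F G al be uniform_rv_id uF
  (fun u v _ _ => erefl).
suff [Hle Heq] : \int[P]_t cost al be (X t) (Y t) <= \int[unif01]_x cost al be x (F x) /\
   (\int[P]_t cost al be (X t) (Y t) = \int[unif01]_x cost al be x (F x) -> eq_copula C G).
  have [l1 l2] := lin _ _ _ _ _ E1 E2.
  by split; [exact: l1 Hle|move/l2].
clear E1 E2.
have FE : \int[unif01]_x cost al be x (F x) = \int[P]_t cost al be (X t) (F (X t)).
  apply/esym; apply: (uniform_rv_integral (g := fun x => cost al be x (F x))
    (M := `|al| + `|be|) uX).
    by apply: measurable_cost => //; exact: (@measurable_id _ mR).
  by move=> x x01; apply: cost_bound => //; exact: F01.
rewrite {}FE.
have igY : P.-integrable setT (EFin \o (fun t => g (Y t))).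
  apply: (@ae_bounded_integrable _ _ _ _ _ M).
    by apply: (@measurableT_comp _ _ _ _ R R g) => //; exact: mg.
  by apply: filterS (uniform_rv_ae uY) => t; exact: gM.
have igF : P.-integrable setT (EFin \o (fun t => g (F (X t)))).
  apply: (@ae_bounded_integrable _ _ _ _ _ M).
    by apply: (@measurableT_comp _ _ _ _ R R g) => //; exact: mg.
  by apply: filterS (uniform_rv_ae uFX) => t; exact: gM.
have gE : \int[P]_t g (Y t) = \int[P]_t g (F (X t)).
  rewrite (uniform_rv_integral uY mg gM).
  by rewrite -(uniform_rv_integral uFX mg gM).
have ic := integrable_cost al be uX uY.
have icF := integrable_cost al be uX uFX.
pose s t := (g (Y t) - cost al be (X t) (Y t)) - (g (F (X t)) - cost al be (X t) (F (X t))).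
have i1 : P.-integrable setT (EFin \o (fun t => g (Y t) - cost al be (X t) (Y t))).
  by have := integrableB measurableT igY ic; apply: eq_integrable.
have i2 : P.-integrable setT (EFin \o (fun t => g (F (X t)) - cost al be (X t) (F (X t)))).
  by have := integrableB measurableT igF icF; apply: eq_integrable.
have is_ : P.-integrable setT (EFin \o s).
  by have := integrableB measurableT i1 i2; apply: eq_integrable.
have sE : \int[P]_t s t = \int[P]_t cost al be (X t) (F (X t)) - \int[P]_t cost al be (X t) (Y t).
  rewrite /s RintegralB//; rewrite (@RintegralB _ _ _ _ _ (fun t => g (Y t)))//.
  rewrite (@RintegralB _ _ _ _ _ (fun t => g (F (X t))))// gE; ring.
have ms : measurable_fun setT (EFin \o s) by case/integrableP : is_.
have sabs : (\int[P]_t (s t)%:E = \int[P]_t `|(s t)%:E|)%E.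
  apply: ae_eq_integral => //; first exact: measurableT_comp.
  apply: filterS2 (uniform_rv_ae uX) (uniform_rv_ae uY) => t Xt Yt _.
  by rewrite gee0_abs// lee_fin; have [] := slack _ _ Xt Yt.
have s0 : 0 <= \int[P]_t s t.
  by rewrite /Rintegral sabs fine_ge0// integral_ge0.
split; first by rewrite -subr_ge0 -sE.
move=> E.
have /(ae_eq_integral_abs P measurableT ms) sae : (\int[P]_t `|(EFin \o s) t| = 0)%E.
  rewrite -sabs -[LHS]fineK; last exact: integrable_fin_num.
  by congr EFin; rewrite -[LHS]/(\int[P]_t s t) sE E subrr.
apply: eq_copula_trans CP' _ => u v u01 v01; rewrite /G /joint_cdf; congr fine.
have mB : measurable ([set x | 1 - x <= u /\ 1 - F x <= v] : set mR).
  rewrite [X in measurable X](_ : _ =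
     [set t : mR | (1 - t <= u) && (1 - F t <= v)]); last first.
    by apply/seteqP; split => t /=; [move=> [-> ->]|move/andP].
  have mid : measurable_fun setT (fun t : mR => 1 - t).
    by apply: measurable_funB => //; exact: (@measurable_id _ mR).
  have mF1 : measurable_fun setT (fun t : mR => 1 - F t) by exact: measurable_funB.
  rewrite -[X in measurable X]setTI.
  have := measurable_and (measurable_fun_ler mid (measurable_cst u))
                (measurable_fun_ler mF1 (measurable_cst v)).
  by move=> /(_ measurableT [set true]); apply.
have [_ PX] := uX.
rewrite -[RHS](PX _ mB); apply: ae_eq_probability.
- rewrite [X in measurable X](_ : _ =
     [set t | (1 - X t <= u) && (1 - Y t <= v)]); last first.
    by apply/seteqP; split => t /=; [move=> [-> ->]|move/andP].
  have mX1 : measurable_fun setT (fun t => 1 - X t) by exact: measurable_funB.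
  have mY1 : measurable_fun setT (fun t => 1 - Y t) by exact: measurable_funB.
  rewrite -[X in measurable X]setTI.
  have := measurable_and (measurable_fun_ler mX1 (measurable_cst u))
                (measurable_fun_ler mY1 (measurable_cst v)).
  by move=> /(_ measurableT [set true]); apply.
- by rewrite -[X in measurable X]setTI; exact: mX.
have nXY : {ae P, forall t, X t != x0 /\ Y t != y0}.
  by apply: filterS2 (uniform_rv_neq x0 uX) (uniform_rv_neq y0 uY).
have XYae : {ae P, forall t, 0 <= X t <= 1 /\ 0 <= Y t <= 1}.
  by apply: filterS2 (uniform_rv_ae uX) (uniform_rv_ae uY).
apply: filterS3 nXY XYae sae => t [Xt0 Yt0] [Xt Yt] st.
have [_ /(_ Xt0 Yt0) YF] := slack _ _ Xt Yt.
rewrite /= YF//; have [] := st I; exact.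
Qed.

(** The absolute value makes the integrand nonnegative everywhere and not just almost everywhere, as
    [integral_mixture] requires. *)
Lemma blest_abs d (T : measurableType d) (P : probability T R) (X Y : T -> R) C :
  uniform_rv P X -> uniform_rv P Y -> eq_copula C (joint_cdf P X Y) ->
  (((blest C + 2) / 12)%:E = \int[P]_t ((1 - X t) ^+ 2 * `|1 - Y t|)%:E)%E.
Proof.
move=> uX uY CP; rewrite (blest_joint_cdf uX uY CP) subrK mulrAC divff// mul1r.
have [mX _] := uX; have [mY _] := uY.
have mX1 : measurable_fun setT (fun t => 1 - X t) by exact: measurable_funB.
have mY1 : measurable_fun setT (fun t => 1 - Y t) by exact: measurable_funB.
rewrite fineK; last first.
  apply: integrable_fin_num => //.
  apply: eq_integrable (integrable_cost 1 0 (uniform_rv_1B uX) (uniform_rv_1B uY)) => // t _.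
  by rewrite /= /cost; congr EFin; ring.
apply: ae_eq_integral => //.
- by apply/measurable_EFinP; apply: measurable_funM => //; exact: measurable_funX.
- apply/measurable_EFinP; apply: measurable_funM; first exact: measurable_funX.
  exact: measurableT_comp.
- apply: filterS (uniform_rv_ae uY) => t /andP[Y0 Y1] _.
  by rewrite ger0_norm// subr_ge0.
Qed.

(** * Convex combinations of copulas *)

Section mixture.
Variables (d : measure_display) (T : measurableType d) (P Q : probability T R).
Variables (t : R) (t0 : 0 <= t) (t1 : 0 <= 1 - t).

Definition mixture : set T -> \bar R :=
  measure_add (mscale (NngNum t0) P) (mscale (NngNum t1) Q).

HB.instance Definition _ := Measure.on mixture.

Lemma mixtureE A : mixture A = (t%:E * P A + (1 - t)%:E * Q A)%E.
Proof. by rewrite /mixture measure_addE. Qed.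

Let mixture_setT : mixture setT = 1%:E.
Proof. by rewrite mixtureE !probability_setT !mule1 -EFinD addrC subrK. Qed.

HB.instance Definition _ :=
  Measure_isProbability.Build _ _ _ mixture mixture_setT.

Lemma integral_mixture (f : T -> \bar R) :
  measurable_fun setT f -> (forall x, 0 <= f x)%E ->
  (\int[mixture]_x f x = t%:E * \int[P]_x f x + (1 - t)%:E * \int[Q]_x f x)%E.
Proof.
move=> mf f0; rewrite ge0_integral_measure_add//.
by rewrite !ge0_integral_mscale.
Qed.

End mixture.

Lemma mixture_copula C D t : 0 <= t <= 1 -> is_copula C -> is_copula D ->
  is_copula (fun u v => t * C u v + (1 - t) * D u v) /\
  blest (fun u v => t * C u v + (1 - t) * D u v) = t * blest C + (1 - t) * blest D.
Proof.
move=> /andP[t0 t1] /is_copulaP[P [uP vP CP]] /is_copulaP[Q [uQ vQ DQ]].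
have t1' : 0 <= 1 - t by rewrite subr_ge0.
pose M : probability _ R := mixture P Q t0 t1'.
have ME A : M A = (t%:E * P A + (1 - t)%:E * Q A)%E := mixtureE P Q t0 t1' A.
have Mint := @integral_mixture _ _ P Q t t0 t1'.
have uM : uniform_rv M (fst : mR * mR -> R).
  split => [|A mA]; first by case: uP.
  have [_ PA] := uP; have [_ QA] := uQ; rewrite ME PA// QA//.
  by rewrite -ge0_muleDl ?lee_fin ?subr_ge0; [rewrite -EFinD addrC subrK mul1e|lra..].
have vM : uniform_rv M (snd : mR * mR -> R).
  split => [|A mA]; first by case: vP.
  have [_ PA] := vP; have [_ QA] := vQ; rewrite ME PA// QA//.
  by rewrite -ge0_muleDl ?lee_fin ?subr_ge0; [rewrite -EFinD addrC subrK mul1e|lra..].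
have MC : eq_copula (fun u v => t * C u v + (1 - t) * D u v) (joint_cdf M fst snd).
  move=> u v u01 v01; rewrite CP// DQ// /joint_cdf.
  have [mf _] := uP; have [ms _] := vP.
  have mA : measurable [set x : mR * mR | x.1 <= u /\ x.2 <= v].
    rewrite [X in measurable X](_ : _ =
       [set x : mR * mR | (x.1 <= u) && (x.2 <= v)]); last first.
      by apply/seteqP; split => x /=; [move=> [-> ->]|move/andP].
    rewrite -[X in measurable X]setTI.
    have := measurable_and (measurable_fun_ler mf (measurable_cst u))
                (measurable_fun_ler ms (measurable_cst v)).
    by move=> /(_ measurableT [set true]); apply.
  by rewrite ME fineD ?fin_numM ?fin_num_measure// !fineM// fin_num_measure.
split; first exact: eq_is_copula MC (joint_cdf_copula uM vM).
have BM := blest_abs uM vM MC.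
rewrite [RHS]Mint in BM; last 2 first.
- apply/measurable_EFinP; apply: measurable_funM.
    by apply: measurable_funX; apply: measurable_funB => //; case: uP.
  by apply: measurableT_comp => //; apply: measurable_funB => //; case: vP.
- by move=> x; rewrite lee_fin mulr_ge0// sqr_ge0.
rewrite -(blest_abs uP vP CP) -(blest_abs uQ vQ DQ) -!EFinM -EFinD in BM.
case: BM.
move: (blest _) (blest C) (blest D) => x y z; lra.
Qed.

End copulas.

(** * The maps T_w and R_b *)

Section extremal_copulas.
Context {R : realType}.
Local Notation mR := (measurableTypeR R).
Local Notation mu := (@lebesgue_measure R).
Implicit Types C D G : R -> R -> R.

(** For a piecewise affine F, both x^2 F(x) and x F(x)^2 are piecewise of this shape, and so are the
    potentials. Explicit coefficients leave the integrals to [field]; [icubic] is the primitive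
    vanishing at 0. *)
Definition cubic (c0 c1 c2 c3 x : R) : R := c0 + c1 * x + c2 * x ^+ 2 + c3 * x ^+ 3.

Definition icubic (c0 c1 c2 c3 x : R) : R :=
  c0 * x + c1 * x ^+ 2 / 2 + c2 * x ^+ 3 / 3 + c3 * x ^+ 4 / 4.

Lemma measurable_cubic c0 c1 c2 c3 : measurable_fun setT (cubic c0 c1 c2 c3 : mR -> R).
Proof.
have mid : measurable_fun setT (fun x : mR => x : R) by exact: (@measurable_id _ mR).
rewrite /cubic; repeat (apply: measurable_funD => //;
  last (apply: measurable_funM => //; exact: measurable_funX)).
by apply: measurable_funD => //; exact: measurable_funM.
Qed.

Lemma cubic_bound c0 c1 c2 c3 x : 0 <= x <= 1 ->
  `|cubic c0 c1 c2 c3 x| <= `|c0| + `|c1| + `|c2| + `|c3|.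
Proof.
move=> /andP[x0 x1]; rewrite /cubic.
have xn (c : R) n : `|c * x ^+ n| <= `|c|.
  by rewrite normrM ler_piMr// ger0_norm ?exprn_ge0// exprn_ile1.
do 3 (rewrite (le_trans (ler_normD _ _))// lerD//).
exact: (xn c1 1%N).
Qed.

Lemma integral_itv_cubic c0 c1 c2 c3 (a b : R) (f : mR -> R) :
  a <= b -> measurable_fun setT f ->
  {in `]a, b[, forall x, f x = cubic c0 c1 c2 c3 x} ->
  (\int[mu]_(x in `[a, b]) (f x)%:E)%E
  = (icubic c0 c1 c2 c3 b - icubic c0 c1 c2 c3 a)%:E.
Proof.
move=> ab mf fE.
pose p : {poly R} := c0%:P + c1 *: 'X + c2 *: 'X^2 + c3 *: 'X^3.
pose q : {poly R} := c0 *: 'X + (c1 / 2) *: 'X^2 + (c2 / 3) *: 'X^3 + (c3 / 4) *: 'X^4.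
have pE x : p.[x] = cubic c0 c1 c2 c3 x.
  by rewrite /p /cubic !(hornerD, hornerZ, hornerXn, hornerX, hornerC).
have qE x : q.[x] = icubic c0 c1 c2 c3 x.
  by rewrite /q /icubic !(hornerD, hornerZ, hornerXn, hornerX, hornerC); field.
have qp : q^`() = p.
  rewrite /q /p !(derivD, derivZ, derivXn, derivX) /= expr1 alg_polyC.
  rewrite -(scaler_nat 2 'X) -(scaler_nat 3 'X^2) -(scaler_nat 4 'X^3) !scalerA.
  by rewrite !divfK ?pnatr_eq0.
rewrite -!qE; apply: (@integral_itv_poly _ a b f p q) => //.
  by move=> x xab; rewrite fE// pE.
exact: measurable_funTS.
Qed.

Lemma integral_itv_split (a m b : R) (f : mR -> R) : a <= m -> m <= b ->
  measurable_fun setT f -> (forall x, a <= x <= b -> 0 <= f x) ->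
  (\int[mu]_(x in `[a, b]) (f x)%:E =
   \int[mu]_(x in `[a, m]) (f x)%:E + \int[mu]_(x in `[m, b]) (f x)%:E)%E.
Proof.
move=> am mb mf f0.
rewrite (@itv_bndbnd_setU _ _ (BLeft a) (BRight m) (BRight b)) ?bnd_simp//.
rewrite ge0_integral_setU//=.
- congr (_ + _)%E; rewrite integral_itv_obnd_cbnd//.
  by apply/measurable_EFinP; exact: measurable_funTS.
- by apply/measurable_EFinP; exact: measurable_funTS.
- by move=> x [|]; rewrite /= in_itv /= => /andP[? ?]; rewrite lee_fin f0//; lra.
- by apply/disj_set2P; apply/seteqP; split => x //=; rewrite !in_itv /= => -[]; lra.
Qed.

(** Breakpoints may coincide: A_w uses m = n = 1 - w and the countermonotone case m = n = 0, which
    leaves empty pieces. *)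
Lemma Rintegral_unif01_cubic (m n : R) c0 c1 c2 c3 d0 d1 d2 d3 e0 e1 e2 e3
    (f : mR -> R) :
  0 <= m -> m <= n -> n <= 1 -> measurable_fun setT f ->
  (forall x, 0 <= x <= 1 -> 0 <= f x) ->
  {in `]0, m[, forall x, f x = cubic c0 c1 c2 c3 x} ->
  {in `]m, n[, forall x, f x = cubic d0 d1 d2 d3 x} ->
  {in `]n, 1[, forall x, f x = cubic e0 e1 e2 e3 x} ->
  \int[unif01]_x f x =
    icubic c0 c1 c2 c3 m + (icubic d0 d1 d2 d3 n - icubic d0 d1 d2 d3 m)
    + (icubic e0 e1 e2 e3 1 - icubic e0 e1 e2 e3 n).
Proof.
move=> m0 mn n1 mf f0 fc fd fe.
rewrite /Rintegral integral_unif01_ge0// (integral_itv_split (m := n))//; last lra.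
rewrite (integral_itv_split (m := m))//; last by move=> x /andP[x0 xn]; apply: f0; lra.
rewrite (integral_itv_cubic _ _ fc)// (integral_itv_cubic _ _ fd)//.
rewrite (integral_itv_cubic _ _ fe)// -!EFinD /= {2}/icubic.
by rewrite !expr0n /= !mulr0 !mul0r !addr0 subr0.
Qed.

Lemma unif01_eq_itv (A : set mR) a b : measurable A -> 0 <= a -> a <= b -> b <= 1 ->
  (forall x, 0 <= x <= 1 -> (A x <-> a <= x <= b)) -> unif01 A = (b - a)%:E.
Proof.
move=> mA a0 ab b1 Aab; rewrite unif01E//.
rewrite -(@unif01_itv R a b true false)// unif01E//; congr (mu _).
apply/seteqP; split => x /=; rewrite !in_itv /= => -[] H x01; split => //.
  exact/(Aab _ x01).
exact/(Aab _ x01).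
Qed.

Lemma measurable_level (F : mR -> R) y : measurable_fun setT F ->
  measurable [set x | F x <= y].
Proof.
move=> mF; rewrite -[X in measurable X]setTI.
exact: (measurable_fun_ler mF (measurable_cst y)).
Qed.

Lemma measurable_T_map (w : R) : measurable_fun setT (T_map w : mR -> R).
Proof.
have -> : T_map w = (fun x => if x <= 1 - w then cubic 1 (-1) 0 0 x else cubic (w - 1) 1 0 0 x).
  by apply/funext => x; rewrite /T_map /cubic; case: ifPn => _; ring.
apply: measurable_fun_ifT; [|exact: measurable_cubic..].
by apply: measurable_fun_ler => //; exact: (@measurable_id _ mR).
Qed.

Lemma uniform_rv_T_map (w : R) : 0 <= w <= 1 -> uniform_rv (@unif01 R) (T_map w).
Proof.
move=> /andP[w0 w1]; apply: unif01_cdf_rv => [|y /andP[y0 y1]].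
  exact: measurable_T_map.
have mL := measurable_level y (measurable_T_map w).
have [wy|yw] := leP w y.
  transitivity (1 - (1 - y))%:E; last by congr EFin; lra.
  apply: unif01_eq_itv => //; try lra.
  by move=> x /andP[x0 x1]; rewrite /= /T_map; case: (leP x (1 - w)) => ?; split; lra.
rewrite unif01E//.
have -> : [set x | T_map w x <= y] `&` `[0, 1] = `]1 - w, y + 1 - w]%classic :> set R.
  apply/seteqP; split => x; rewrite /= !in_itv /= /T_map.
    by case: (leP x (1 - w)) => ? []; lra.
  by case: (leP x (1 - w)) => ?; lra.
rewrite lebesgue_measure_itv /= lte_fin -EFinB.
by case: ltP => ?; congr EFin; lra.
Qed.

Lemma T_map01 (w x : R) : 0 <= w <= 1 -> 0 <= x <= 1 -> 0 <= T_map w x <= 1.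
Proof. by rewrite /T_map; case: (leP x (1 - w)); lra. Qed.

Lemma measurable_R_map (b : R) : measurable_fun setT (R_map b : mR -> R).
Proof.
have -> : R_map b = (fun z => if z <= z_param b then cubic (1 - b) (2 * (1 - b)) 0 0 z
   else if z <= b then cubic ((1 - b) / (1 - 2 * b)) (- 2 * ((1 - b) / (1 - 2 * b))) 0 0 z
   else cubic 1 (-1) 0 0 z).
  by apply/funext => z; rewrite /R_map /cubic; case: ifPn => _; [|case: ifPn => _]; ring.
have mle c : measurable_fun setT (fun x : mR => x <= c).
  by apply: measurable_fun_ler => //; exact: (@measurable_id _ mR).
apply: measurable_fun_ifT => //; first exact: measurable_cubic.
by apply: measurable_fun_ifT => //; exact: measurable_cubic.
Qed.

Lemma z_paramE (b : R) : 0 < b < 1 / 2 -> 2 * (1 - b) * z_param b = b.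
Proof. by move=> /andP[b0 b2]; rewrite /z_param; field; lra. Qed.

Lemma R_map_ge (b r z : R) : 0 < b < 1 / 2 -> 0 <= r <= 1 -> 0 <= z <= 1 -> 1 - b < r ->
  (r <= R_map b z) =
  ((r - (1 - b)) / (2 * (1 - b)) <= z <= (1 - r * (1 - 2 * b) / (1 - b)) / 2).
Proof.
move=> bI /andP[r0 r1] /andP[y0 y1] rb; have /andP[z0 zb] := z_param_lt bI.
have zE := z_paramE bI.
have /andP[b0 b2] := bI.
have s0 : 0 < 1 - b by lra.
have t0 : 0 < 1 - 2 * b by lra.
rewrite ler_pdivrMr; last lra.
rewrite ler_pdivlMr// lerBrDr -lerBrDl ler_pdivrMr//.
have k1 : (1 - b) * z_param b * 2 = b by lra.
have sz (u v : R) : u <= v -> (1 - b) * u <= (1 - b) * v by move=> uv; rewrite ler_pM2l.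
rewrite /R_map; case: (leP z (z_param b)) => [/sz zz|zz].
  have q1 : r * (1 - 2 * b) <= (1 - z * 2) * (1 - b).
    have : r * (1 - 2 * b) <= 1 * (1 - 2 * b) by rewrite ler_pM2r.
    lra.
  by rewrite q1 andbT; apply/idP/idP; lra.
have {}zz : (1 - b) * z_param b <= (1 - b) * z by rewrite ler_pM2l// ltW.
case: (leP z b) => [zb'|bz].
  have [p1|p1] := leP r ((1 - b) * (1 - 2 * z) / (1 - 2 * b)).
    move: p1; rewrite ler_pdivlMr// => p1; apply/esym/andP; split; lra.
  move: p1; rewrite ltr_pdivrMr// => p1; apply/esym/negbTE/negP => /andP[_]; lra.
have q1 : (1 - b) * b < (1 - b) * z by rewrite ltr_pM2l.
have q2 : (1 - b) * (1 - 2 * b) < r * (1 - 2 * b) by rewrite ltr_pM2r.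
have -> : (r <= 1 - z) = false by apply/negbTE/negP; lra.
by apply/esym/negbTE/negP => /andP[_]; lra.
Qed.

Lemma R_map_ge_lo (b r z : R) : 0 < b < 1 / 2 -> 0 <= r <= 1 -> 0 <= z <= 1 -> r <= 1 - b ->
  (r <= R_map b z) = (z <= 1 - r).
Proof.
move=> bI /andP[r0 r1] /andP[y0 y1] rb; have /andP[z0 zb] := z_param_lt bI.
have /andP[b0 b2] := bI.
have s0 : 0 < 1 - b by lra.
rewrite /R_map; case: (leP z (z_param b)) => zz.
  have : 0 <= (1 - b) * z by rewrite mulr_ge0// ltW.
  by move=> ?; apply/idP/idP; lra.
case: (leP z b) => [zb'|bz]; last by apply/idP/idP; lra.
have -> : r <= (1 - b) * (1 - 2 * z) / (1 - 2 * b).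
  rewrite (le_trans rb)// ler_pdivlMr ?ler_pM2l//; lra.
by apply/esym; lra.
Qed.

Lemma R_map01 (b z : R) : 0 < b < 1 / 2 -> 0 <= z <= 1 -> 0 <= R_map b z <= 1.
Proof.
move=> bI /andP[y0 y1]; have /andP[z0 zb] := z_param_lt bI.
have zE := z_paramE bI.
have /andP[b0 b2] := bI.
have s0 : 0 < 1 - b by lra.
rewrite /R_map; case: (leP z (z_param b)) => zz.
  have : (1 - b) * z <= (1 - b) * z_param b by rewrite ler_pM2l.
  have : 0 <= (1 - b) * z by rewrite mulr_ge0// ltW.
  lra.
case: (leP z b) => [zb'|bz]; last lra.
have : (1 - b) * z_param b <= (1 - b) * z by rewrite ler_pM2l// ltW.
rewrite divr_ge0 ?mulr_ge0//=; try lra.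
by rewrite ler_pdivrMr; lra.
Qed.

(** The distribution function is computed for 1 - R_b, whose sublevel sets are superlevel sets of
    R_b and hence intervals. *)
Lemma uniform_rv_R_map (b : R) : 0 < b < 1 / 2 -> uniform_rv (@unif01 R) (R_map b).
Proof.
move=> bI.
have mR1 : measurable_fun setT ((fun z => 1 - R_map b z) : mR -> R).
  by apply: measurable_funB => //; exact: measurable_R_map.
suff uR : uniform_rv (@unif01 R) (fun z => 1 - R_map b z).
  have := uniform_rv_1B uR; congr (uniform_rv _ _).
  by apply/funext => z; rewrite opprB addrC subrK.
apply: unif01_cdf_rv => // y /andP[y0 y1].
have /andP[b0 b2] := bI.
have s0 : 0 < 1 - b by lra.
have mL := measurable_level y mR1.
have E z : (1 - R_map b z <= y) = (1 - y <= R_map b z) by apply/idP/idP; lra.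
have [yb|by_] := leP (1 - y) (1 - b).
  rewrite -[y in RHS]subr0; apply: unif01_eq_itv => //.
  move=> z /andP[z0 z1]; rewrite /= E R_map_ge_lo ?z0 ?z1//; last lra.
  by rewrite opprB addrC subrK.
have z1' : 0 <= (1 - y - (1 - b)) / (2 * (1 - b)) by rewrite divr_ge0; lra.
have dE : (1 - (1 - y) * (1 - 2 * b) / (1 - b)) / 2
    - (1 - y - (1 - b)) / (2 * (1 - b)) = y by field; lra.
have q0 : 0 <= (1 - y) * (1 - 2 * b) / (1 - b).
  by rewrite divr_ge0 ?mulr_ge0; lra.
rewrite -[in RHS]dE; apply: unif01_eq_itv => //; try lra.
by move=> z z01; rewrite /= E R_map_ge//; lra.
Qed.

End extremal_copulas.

(** * Extremal copulas *)

Section extremal_values.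
Local Opaque blest joint_cdf.
Context {R : realType}.
Local Notation mR := (measurableTypeR R).
Implicit Types C D G : R -> R -> R.

Lemma piecewise_bound (lo hi : R -> R) c k M1 M2 x :
  `|lo x| <= M1 -> `|hi x| <= M2 ->
  `|if x <= c then lo x else k + hi x| <= M1 + (`|k| + M2).
Proof.
move=> h1 h2; have M10 : 0 <= M1 := le_trans (normr_ge0 _) h1.
have M20 : 0 <= M2 := le_trans (normr_ge0 _) h2.
have := normr_ge0 k; case: ifPn => _; first lra.
have := ler_normD k (hi x); lra.
Qed.

Lemma measurable_piecewise_cubic (c k c0 c1 c2 c3 d0 d1 d2 d3 : R) :
  measurable_fun setT ((fun x => if x <= c then cubic c0 c1 c2 c3 x
    else k + cubic d0 d1 d2 d3 x) : mR -> R).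
Proof.
apply: measurable_fun_ifT.
- by apply: measurable_fun_ler => //; exact: (@measurable_id _ mR).
- exact: measurable_cubic.
- by apply: measurable_funD => //; exact: measurable_cubic.
Qed.

Lemma potA_cubic (w : R) : potA w = (fun y => if y <= w
  then cubic 0 ((1 - w) ^+ 2) ((1 - w) - muA w * (1 - w)) (1 / 3 - 2 * muA w / 3) y
  else (potA_lo w w - potA_hi w w) + cubic 0 1 (- 1 - muA w) (1 / 3 + 2 * muA w / 3) y).
Proof.
apply/funext => y; rewrite /potA /cubic; case: ifPn => _.
  by rewrite /potA_lo; field.
by rewrite addrAC; congr (_ + _); rewrite /potA_hi; field.
Qed.

Lemma lagrangian_l (m a b c d : R) (Q : Prop) :
  1 * a + - m * b <= 1 * c + - m * d /\ (1 * a + - m * b = 1 * c + - m * d -> Q) ->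
  a - m * b <= c - m * d /\ (a - m * b = c - m * d -> Q).
Proof. by rewrite !mul1r !mulNr. Qed.

Lemma lagrangian_r (m a b c d : R) (Q : Prop) :
  - m * b + 1 * a <= - m * d + 1 * c /\ (- m * b + 1 * a = - m * d + 1 * c -> Q) ->
  a - m * b <= c - m * d /\ (a - m * b = c - m * d -> Q).
Proof. by rewrite !mul1r !mulNr ![- _ + _]addrC. Qed.

Lemma A_copula_transport (w : R) C : 1 / 2 <= w <= 1 -> is_copula C ->
  blest C - muA w * blest (transpose C)
    <= blest (A_copula w) - muA w * blest (transpose (A_copula w)) /\
  (blest C - muA w * blest (transpose C)
    = blest (A_copula w) - muA w * blest (transpose (A_copula w)) ->
   eq_copula C (A_copula w)).
Proof.
move=> wI cC; have w01 : 0 <= w <= 1 by lra.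
have mg : measurable_fun setT (potA w : mR -> R).
  by rewrite potA_cubic; exact: measurable_piecewise_cubic.
have [M gM] : exists M, forall y, 0 <= y <= 1 -> `|potA w y| <= M.
  eexists => y y01; rewrite potA_cubic.
  by apply: piecewise_bound; exact: cubic_bound.
apply: lagrangian_l; apply: (transport_bound (M := M) (x0 := 1 - w) (y0 := w)
  (uniform_rv_T_map w01) (fun x => T_map01 w01) mg gM _ cC) => x y x01 y01 s.
have [s0 sE] := slackA_ge0 wI x01 y01.
by split; [exact: s0|exact: sE].
Qed.

Lemma A_copula_is_copula (w : R) : 0 <= w <= 1 -> is_copula (A_copula w).
Proof.
move=> w01; apply: joint_cdf_copula; first exact: uniform_rv_onem.
exact/uniform_rv_1B/uniform_rv_T_map.
Qed.

Lemma blest_transport (F : mR -> R) : uniform_rv (@unif01 R) F ->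
  let G := joint_cdf unif01 (fun x => 1 - x) (fun x => 1 - F x) in
  blest G = 12 * (\int[@unif01 R]_x (x ^+ 2 * F x)) - 2 /\
  blest (transpose G) = 12 * (\int[@unif01 R]_x (x * F x ^+ 2)) - 2.
Proof.
move=> uF G.
have l1 (x y i : R) : 1 * x + 0 * y = 12 * i - 2 * (1 + 0) -> x = 12 * i - 2 by lra.
have l2 (x y i : R) : 0 * x + 1 * y = 12 * i - 2 * (0 + 1) -> y = 12 * i - 2 by lra.
have /l1 E1 := @blest_cost _ _ _ _ (idfun : mR -> R) F G 1 0 uniform_rv_id uF
  (fun u v _ _ => erefl).
have /l2 E2 := @blest_cost _ _ _ _ (idfun : mR -> R) F G 0 1 uniform_rv_id uF
  (fun u v _ _ => erefl).
split; [rewrite E1|rewrite E2]; congr (12 * _ - 2);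
  by apply: eq_Rintegral => x _; rewrite /cost /=; ring.
Qed.

(** The half-sum of the two values is 2 w^3 - 1: this is why [w] is a fourth root in terms of
    nu(C^T) and a cube root in terms of eta. *)
Lemma blest_A_copula (w : R) : 0 <= w <= 1 ->
  blest (A_copula w) = 4 * w ^+ 3 - 2 * w ^+ 4 - 1 /\
  blest (transpose (A_copula w)) = 2 * w ^+ 4 - 1.
Proof.
move=> w01; have [E1 E2] := blest_transport (uniform_rv_T_map w01).
have mid : measurable_fun setT (fun x : mR => x : R) by exact: (@measurable_id _ mR).
have mT := measurable_T_map w.
rewrite /A_copula {}E1 {}E2.
rewrite (@Rintegral_unif01_cubic _ (1 - w) (1 - w) 0 0 1 (-1) 0 0 0 0 0 0 (w - 1) 1);
  try lra; last 5 first.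
- by apply: measurable_funM => //; exact: measurable_funX.
- by move=> x x01; have := T_map01 w01 x01 => /andP[? _]; rewrite mulr_ge0// sqr_ge0.
- move=> x; rewrite in_itv /= => /andP[_ xw]; rewrite /T_map (ltW xw) /cubic; ring.
- by move=> x; rewrite in_itv /=; lra.
- move=> x; rewrite in_itv /= => /andP[wx _]; rewrite /T_map leNgt wx /= /cubic; ring.
rewrite (@Rintegral_unif01_cubic _ (1 - w) (1 - w) 0 1 (- 2) 1 0 0 0 0
   0 ((w - 1) ^+ 2) (2 * (w - 1)) 1);
  try lra; last 5 first.
- by apply: measurable_funM => //; exact: measurable_funX.
- by move=> x x01; rewrite mulr_ge0// ?sqr_ge0//; lra.
- move=> x; rewrite in_itv /= => /andP[_ xw]; rewrite /T_map (ltW xw) /cubic; ring.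
- by move=> x; rewrite in_itv /=; lra.
- move=> x; rewrite in_itv /= => /andP[wx _]; rewrite /T_map leNgt wx /= /cubic; ring.
by rewrite /icubic; split; field.
Qed.

Lemma transposeK C : transpose (transpose C) = C.
Proof. by []. Qed.

Lemma potB_cubic (b : R) : 0 < b < 1 / 2 -> potB b = (fun x => if x <= 1 - b
  then cubic (muB b / 3) (- muB b) (1 + muB b) (- 2 / 3 - muB b / 3) x
  else (potB_lo b (1 - b) - potB_hi b (1 - b))
    + cubic ((1 - b) ^+ 2 / (6 * b)) (- ((1 - b) / (2 * b))) (1 / (2 * b) - 1 / 2)
        (1 / (3 * (1 - b)) - 1 / (6 * b * (1 - b))) x).
Proof.
move=> /andP[b0 b2]; have bn0 : b != 0 by rewrite gt_eqF.
have sn0 : 1 - b != 0 by rewrite gt_eqF//; lra.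
apply/funext => y; rewrite /potB /cubic; case: ifPn => _.
  by rewrite /potB_lo; field.
by rewrite addrAC; congr (_ + _); rewrite /potB_hi; field; rewrite sn0 bn0.
Qed.

Lemma B_copulaE (b : R) :
  B_copula b = transpose (joint_cdf unif01 (fun z => 1 - z) (fun z => 1 - R_map b z)).
Proof. by rewrite joint_cdfC. Qed.

(** R_b maps Y to X, so the transport bound is applied to the transpose of C, with the two cost
    coefficients exchanged and the roles of the exceptional lines swapped, and the result is
    transposed back. *)
Lemma B_copula_transport (b : R) C : 0 < b < 1 / 2 -> is_copula C ->
  blest C - muB b * blest (transpose C)
    <= blest (B_copula b) - muB b * blest (transpose (B_copula b)) /\
  (blest C - muB b * blest (transpose C)
    = blest (B_copula b) - muB b * blest (transpose (B_copula b)) ->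
   eq_copula C (B_copula b)).
Proof.
move=> bI cC.
have mg : measurable_fun setT (potB b : mR -> R).
  by rewrite potB_cubic//; exact: measurable_piecewise_cubic.
have [M gM] : exists M, forall y, 0 <= y <= 1 -> `|potB b y| <= M.
  eexists => y y01; rewrite potB_cubic//.
  by apply: piecewise_bound; exact: cubic_bound.
apply: lagrangian_r; rewrite B_copulaE transposeK.
have [x y x01 y01 s||Hle Heq] := transport_bound (M := M) (x0 := z_param b) (y0 := 1 - b)
  (al := - muB b) (be := 1) (C := transpose C)
  (uniform_rv_R_map bI) (fun x => R_map01 bI) mg gM.
- have [s0 sE] := slackB_ge0 bI y01 x01.
  have cC' u v : cost (- muB b) 1 u v = cost 1 (- muB b) v u :> R.
    by rewrite /cost; ring.
  by rewrite /s !cC'; split; [exact: s0|move=> xz yb; exact: sE].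
- exact: is_copula_transpose.
split; first exact: Hle.
by move/Heq => CG; exact: eq_copula_transpose CG.
Qed.

Lemma B_copula_is_copula (b : R) : 0 < b < 1 / 2 -> is_copula (B_copula b).
Proof.
move=> bI; apply: joint_cdf_copula; last exact: uniform_rv_onem.
exact/uniform_rv_1B/uniform_rv_R_map.
Qed.

(** The origin of the parametric formulas in [Lambda]; the half-sum and half-difference of these two
    values are [e_param] and [upsilon_param]. *)
Lemma blest_B_copula (b : R) : 0 < b < 1 / 2 ->
  blest (B_copula b) = lambda_param b /\
  blest (transpose (B_copula b)) = n_param b.
Proof.
move=> bI.
have mid : measurable_fun setT (fun x : mR => x : R) by exact: (@measurable_id _ mR).
have mT := measurable_R_map b.
have /andP[z0 zb] := z_param_lt bI.
have /andP[b0 b2] := bI.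
have bn0 : b != 0 by rewrite gt_eqF.
have sn0 : 1 - b != 0 by rewrite gt_eqF//; lra.
have tn0 : 1 - 2 * b != 0 by rewrite gt_eqF//; lra.
have Rlo x : x \in `]0, z_param b[ -> R_map b x = 2 * (1 - b) * x + 1 - b.
  by rewrite in_itv /= => /andP[_ xz]; rewrite /R_map (ltW xz).
have Rmi x : x \in `]z_param b, b[ -> R_map b x = (1 - b) * (1 - 2 * x) / (1 - 2 * b).
  by rewrite in_itv /= => /andP[zx xb]; rewrite /R_map leNgt zx (ltW xb).
have Rhi x : x \in `]b, 1[ -> R_map b x = 1 - x.
  by rewrite in_itv /= => /andP[bx _]; rewrite /R_map !leNgt bx (lt_trans zb bx).
have [E1 E2] := blest_transport (uniform_rv_R_map bI).
rewrite B_copulaE transposeK {}E2 {}E1.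
rewrite (@Rintegral_unif01_cubic _ (z_param b) b
   0 ((1 - b) ^+ 2) (4 * (1 - b) ^+ 2) (4 * (1 - b) ^+ 2)
   0 (((1 - b) / (1 - 2 * b)) ^+ 2) (- 4 * ((1 - b) / (1 - 2 * b)) ^+ 2)
   (4 * ((1 - b) / (1 - 2 * b)) ^+ 2)
   0 1 (- 2) 1);
  try lra; last 5 first.
- by apply: measurable_funM => //; exact: measurable_funX.
- by move=> x x01; rewrite mulr_ge0// ?sqr_ge0//; lra.
- by move=> x /Rlo ->; rewrite /cubic; ring.
- by move=> x /Rmi ->; rewrite /cubic; field.
- by move=> x /Rhi ->; rewrite /cubic; ring.
rewrite (@Rintegral_unif01_cubic _ (z_param b) b 0 0 (1 - b) (2 * (1 - b))
   0 0 ((1 - b) / (1 - 2 * b)) (- 2 * ((1 - b) / (1 - 2 * b))) 0 0 1 (-1));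
  try lra; last 5 first.
- by apply: measurable_funM => //; exact: measurable_funX.
- by move=> x x01; have := R_map01 bI x01 => /andP[? _]; rewrite mulr_ge0// sqr_ge0.
- by move=> x /Rlo ->; rewrite /cubic; ring.
- by move=> x /Rmi ->; rewrite /cubic; field.
- by move=> x /Rhi ->; rewrite /cubic; ring.
rewrite /icubic /lambda_param /n_param /z_param.
by split; field; rewrite ?sn0 ?tn0.
Qed.

Lemma blest_countermonotone :
  let G := joint_cdf (@unif01 R) (fun x => 1 - x) (fun x => 1 - (1 - x)) in
  blest G = -1.
Proof.
have [E1 _] := blest_transport uniform_rv_onem.
have mid : measurable_fun setT (fun x : mR => x : R) by exact: (@measurable_id _ mR).
rewrite /= E1 (@Rintegral_unif01_cubic _ 0 0 0 0 0 0 0 0 0 0 0 0 1 (-1));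
  try lra; last 5 first.
- by apply: measurable_funM; [exact: measurable_funX|exact: measurable_funB].
- by move=> x x01; rewrite mulr_ge0// ?sqr_ge0//; lra.
- by move=> x; rewrite in_itv /=; lra.
- by move=> x; rewrite in_itv /=; lra.
- by move=> x _; rewrite /cubic; ring.
by rewrite /icubic; field.
Qed.

Local Transparent joint_cdf.
Lemma W_copulaE :
  eq_copula (joint_cdf (@unif01 R) (fun x => 1 - x) (fun x => 1 - (1 - x))) W_copula.
Proof.
move=> u v; rewrite !in_itv /= => /andP[u0 u1] /andP[v0 v1].
rewrite /joint_cdf /W_copula.
rewrite [X in unif01 X](_ : _ = `[1 - u, v]%classic); last first.
  by apply/seteqP; split => x; rewrite /= in_itv /=; [case|move=> ?; split]; lra.
have [uv|uv] := leP (1 - u) v.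
  by rewrite unif01_itv//; [rewrite /= max_l; lra|lra].
by rewrite set_itv_ge ?measure0 ?bnd_simp -?ltNge//= max_r; lra.
Qed.

Local Opaque joint_cdf.
Lemma blest_min C : is_copula C ->
  -1 <= blest C /\ (blest C = -1 -> eq_copula C W_copula).
Proof.
have lin (x y z t : R) : z = -1 ->
    -1 * x + 0 * y <= -1 * z + 0 * t -> -1 <= x by move=> ->; lra.
have lin' (x y z t : R) : z = -1 -> x = -1 ->
    -1 * x + 0 * y = -1 * z + 0 * t by move=> -> ->; lra.
move=> cC.
have potWE' : @potW R = cubic (1 / 3) (-1) 1 (- 1 / 3).
  by apply/funext => y; rewrite /potW /cubic; field.
have mg : measurable_fun setT (@potW R : mR -> R).
  by rewrite potWE'; exact: measurable_cubic.
have [M gM] : exists M, forall y, 0 <= y <= 1 -> `|@potW R y| <= M.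
  by eexists => y y01; rewrite potWE'; exact: cubic_bound.
have bW := blest_countermonotone.
have F01 (x : R) : 0 <= x <= 1 -> 0 <= 1 - x <= 1 by lra.
(* No height is exceptional here; [y0] is set to 2, a value outside [0, 1]. *)
have [x y x01 y01 s||Hle Heq] := transport_bound (F := fun x => 1 - x) (M := M)
  (x0 := 0) (y0 := 2) (al := -1) (be := 0) (C := C) uniform_rv_onem F01 mg gM.
- have [s0 sE] := slackW_ge0 x01 y01.
  by split; [exact: s0|move=> x0 _; exact: sE].
- exact: cC.
split; first exact: lin bW Hle.
by move=> E; apply: eq_copula_trans W_copulaE; apply: Heq; exact: lin'.
Qed.

End extremal_values.

(** * The functions Lambda and Upsilon *)

Section lambda_upsilon.
Context {R : realType}.
Implicit Types b e n q w x y : R.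

Lemma powRVn x (k m : nat) : 0 <= x -> (0 < m)%N -> (x ^+ m) `^ (k%:R / m%:R) = x ^+ k.
Proof.
move=> x0 m0; rewrite -powR_mulrn// -powRrM mulrC divfK ?powR_mulrn//.
by rewrite pnatr_eq0 -lt0n.
Qed.

Lemma ex_root x (m : nat) : 0 <= x -> (0 < m)%N ->
  0 <= x `^ (1 / m%:R) /\ (x `^ (1 / m%:R)) ^+ m = x.
Proof.
move=> x0 m0; split; first exact: powR_ge0.
by rewrite -powR_mulrn ?powR_ge0// -powRrM divfK ?powRr1// pnatr_eq0 -lt0n.
Qed.

Lemma ltrXn2 x y (m : nat) : 0 <= x -> 0 <= y -> (0 < m)%N ->
  (x ^+ m < y ^+ m) = (x < y).
Proof. by move=> x0 y0 m0; rewrite ltr_pXn2r// -?lt0n//; case: m m0. Qed.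

Lemma lerXn2 x y (m : nat) : 0 <= x -> 0 <= y -> (0 < m)%N ->
  (x ^+ m <= y ^+ m) = (x <= y).
Proof. by move=> x0 y0 m0; rewrite leNgt ltrXn2// -leNgt. Qed.

Lemma lt_inv1B x y : x < y -> y < 1 -> 0 < (1 - x)^-1 < (1 - y)^-1.
Proof.
by move=> xy y1; rewrite invr_gt0 ltf_pV2 ?posrE; [apply/andP; split|..]; lra.
Qed.

(** Apart from the constants, a product of nonnegative increasing factors; z (3 - 2 z) increases
    because x + y < 1. The same splitting serves [lambda_param] and [e_param]. *)
Lemma n_param_lt x y : 0 <= x -> x < y -> y <= 1 / 2 -> n_param x < n_param y.
Proof.
move=> x0 xy y2; have E z : n_param z = -1 + z ^+ 3 * (z * (3 - 2 * z)) * ((1 - z)^-1 ^+ 2) / 4.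
  by rewrite /n_param exprVn invfM; ring.
rewrite !E ltrD2l ltr_pM2r ?invr_gt0//.
have /andP[i0 ixy] := @lt_inv1B x y xy (ltac:(lra)).
apply: ltr_pM.
- by rewrite mulr_ge0 ?exprn_ge0 ?mulr_ge0//; lra.
- by rewrite sqr_ge0.
- apply: ltr_pM; rewrite ?exprn_ge0 ?mulr_ge0 ?ltrXn2//; try lra.
  rewrite -subr_gt0 (_ : _ - _ = (y - x) * (3 - 2 * (x + y))); last ring.
  by apply: mulr_gt0; lra.
- by rewrite ltrXn2//; lra.
Qed.

Lemma lambda_param_lt x y : 0 <= x -> x < y -> y <= 1 / 2 -> lambda_param x < lambda_param y.
Proof.
move=> x0 xy y2; have E z : lambda_param z = -1 + z ^+ 2 * (z * (2 - z)) * (1 - z)^-1.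
  by rewrite /lambda_param; ring.
rewrite !E ltrD2l.
have /andP[i0 ixy] := @lt_inv1B x y xy (ltac:(lra)).
apply: ltr_pM => //.
- by rewrite mulr_ge0 ?exprn_ge0 ?mulr_ge0//; lra.
- by rewrite ltW.
- apply: ltr_pM; rewrite ?exprn_ge0 ?mulr_ge0 ?ltrXn2//; try lra.
  rewrite -subr_gt0 (_ : _ - _ = (y - x) * (2 - (x + y))); last ring.
  by apply: mulr_gt0; lra.
Qed.

Lemma e_param_lt x y : 0 <= x -> x < y -> y <= 1 / 2 -> e_param x < e_param y.
Proof.
move=> x0 xy y2.
have E z : e_param z = -1 + z ^+ 2 * (z * (2 * z ^+ 2 - 9 * z + 8)) * ((1 - z)^-1 ^+ 2) / 8.
  by rewrite /e_param exprVn invfM; ring.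
rewrite !E ltrD2l ltr_pM2r ?invr_gt0//.
have /andP[i0 ixy] := @lt_inv1B x y xy (ltac:(lra)).
have q0 : 0 <= 2 * x ^+ 2 - 9 * x + 8 by have := sqr_ge0 x; lra.
apply: ltr_pM.
- by rewrite mulr_ge0 ?exprn_ge0 ?mulr_ge0.
- by rewrite sqr_ge0.
- apply: ltr_pM; rewrite ?exprn_ge0 ?mulr_ge0 ?ltrXn2//; try lra.
  (* The divided difference is written in s = x + y and x - y; its part in s equals 1/2 + (1 - s)
     (15/2 - 3 s / 2), which is positive for s <= 1. *)
  rewrite -subr_gt0 (_ : _ - _ = (y - x) * (8 - 9 * (x + y) + 3 / 2 * (x + y) ^+ 2
     + (x - y) ^+ 2 / 2)); last by field.
  apply: mulr_gt0; first lra.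
  apply: ltr_pwDl; last by rewrite divr_ge0// sqr_ge0.
  rewrite (_ : _ + _ = 1 / 2 + (1 - (x + y)) * (15 / 2 - 3 / 2 * (x + y))); last by field.
  by apply: ltr_pwDl; [lra|apply: mulr_ge0; lra].
- by rewrite ltrXn2//; lra.
Qed.

Lemma n_param_half : n_param (1 / 2 : R) = - (7 / 8).
Proof. by rewrite /n_param; field. Qed.

Lemma lambda_param_half : lambda_param (1 / 2 : R) = - (5 / 8).
Proof. by rewrite /lambda_param; field. Qed.

Lemma e_param_half : e_param (1 / 2 : R) = - (3 / 4).
Proof. by rewrite /e_param; field. Qed.

Lemma n_param0 : n_param (0 : R) = -1.
Proof. by rewrite /n_param expr0n /= !mul0r addr0. Qed.

Lemma lambda_param0 : lambda_param (0 : R) = -1.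
Proof. by rewrite /lambda_param expr0n /= mulr0 mul0r addr0. Qed.

Lemma e_param0 : e_param (0 : R) = -1.
Proof. by rewrite /e_param expr0n /= !mul0r addr0. Qed.

Lemma b_rangeE b : b_range b = (0 < b < 1 / 2) :> Prop.
Proof. by rewrite /b_range /= in_itv. Qed.

(** The injectivity that [pinvKV] needs to undo the parametrizations inside [Lambda] and
    [Upsilon]. *)
Lemma inj_b_range (f : R -> R) :
  (forall x y, 0 <= x -> x < y -> y <= 1 / 2 -> f x < f y) ->
  {in b_range &, injective f}.
Proof.
move=> fl x y; rewrite !inE !b_rangeE => /andP[x0 x2] /andP[y0 y2] fxy.
have [xy|yx|//] := ltgtP x y.
  by have := fl x y (ltW x0) xy (ltW y2); rewrite fxy ltxx.
by have := fl y x (ltW y0) yx (ltW x2); rewrite fxy ltxx.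
Qed.

Lemma param_itv (f : R -> R) b l r : 0 < b < 1 / 2 -> f 0 = l -> f (1 / 2) = r ->
  (forall x y, 0 <= x -> x < y -> y <= 1 / 2 -> f x < f y) -> l < f b < r.
Proof. by move=> /andP[b0 b2] <- <- fl; apply/andP; split; apply: fl; lra. Qed.

Lemma Lambda_A w : 1 / 2 <= w <= 1 ->
  Lambda (2 * w ^+ 4 - 1) = 4 * w ^+ 3 - 2 * w ^+ 4 - 1.
Proof.
move=> /andP[w2 w1]; have w4 : (1 / 2) ^+ 4 <= w ^+ 4 by rewrite lerXn2//; lra.
have {}w4 : 1 / 16 <= w ^+ 4 by lra.
rewrite /Lambda gt_eqF ?ifT; try lra.
have -> : (1 + (2 * w ^+ 4 - 1)) / 2 = w ^+ 4 by field.
by rewrite (powRVn 3 (m := 4))//; [ring|lra].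
Qed.

Lemma Lambda_B b : 0 < b < 1 / 2 -> Lambda (n_param b) = lambda_param b.
Proof.
move=> bI; have /andP[n1 n2] := param_itv bI n_param0 n_param_half n_param_lt.
rewrite /Lambda gt_eqF// ifF; last by apply/negbTE; rewrite -ltNge.
by rewrite pinvKV ?inE ?b_rangeE//; exact: inj_b_range n_param_lt.
Qed.

Lemma Lambda_N1 : Lambda (-1 : R) = -1.
Proof. by rewrite /Lambda eqxx. Qed.

Lemma Upsilon_A w : 1 / 2 <= w <= 1 -> Upsilon (2 * w ^+ 3 - 1) = 2 * w ^+ 3 - 2 * w ^+ 4.
Proof.
move=> /andP[w2 w1]; have w3 : (1 / 2) ^+ 3 <= w ^+ 3 by rewrite lerXn2//; lra.
have {}w3 : 1 / 8 <= w ^+ 3 by lra.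
rewrite /Upsilon gt_eqF ?ifT; try lra.
have -> : 1 + (2 * w ^+ 3 - 1) = 2 * w ^+ 3 by ring.
rewrite powRM ?(powRVn 4 (m := 3))//; try lra.
(* The exponents -1/3 and 4/3 of 2 add up to 1, so the subtracted term is 2 w^4. *)
rewrite mulrA -powRD; last by apply/implyP => _; rewrite pnatr_eq0.
by rewrite (_ : - (1 / 3) + 4 / 3 = 1) ?powRr1//; field.
Qed.

Lemma Upsilon_B b : 0 < b < 1 / 2 -> Upsilon (e_param b) = upsilon_param b.
Proof.
move=> bI; have /andP[n1 n2] := param_itv bI e_param0 e_param_half e_param_lt.
rewrite /Upsilon gt_eqF// ifF; last by apply/negbTE; rewrite -ltNge.
by rewrite pinvKV ?inE ?b_rangeE//; exact: inj_b_range e_param_lt.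
Qed.

Lemma Upsilon_N1 : Upsilon (-1 : R) = 0.
Proof. by rewrite /Upsilon eqxx. Qed.

Lemma ex_w_n q : - (7 / 8) <= q <= 1 -> let w := ((1 + q) / 2) `^ (1 / 4) in
  1 / 2 <= w <= 1 /\ q = 2 * w ^+ 4 - 1.
Proof.
move=> /andP[q8 q1] w; have [|//|w0 w4] := @ex_root ((1 + q) / 2) 4; first lra.
rewrite -/w in w0 w4; split; last lra.
apply/andP; split.
  by rewrite -(@lerXn2 (1 / 2) w 4)// ?w4; lra.
by rewrite -(@lerXn2 w 1 4)// expr1n w4; lra.
Qed.

Lemma ex_w_e e : - (3 / 4) <= e <= 1 -> exists2 w, 1 / 2 <= w <= 1 & e = 2 * w ^+ 3 - 1.
Proof.
move=> /andP[q8 q1]; have [|//|] := @ex_root ((1 + e) / 2) 3; first lra.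
set w := _ `^ _ => w0 w3; exists w; last lra.
apply/andP; split.
  by rewrite -(@lerXn2 (1 / 2) w 3)// ?w3; lra.
by rewrite -(@lerXn2 w 1 3)// expr1n w3; lra.
Qed.

(** Multiplying out the powers of 1 - b turns each parametric equation into a sign change of a
    polynomial between 0 and 1/2; strict signs at the ends keep the root in the open interval. *)
Lemma ex_b_poly (p : {poly R}) : p.[0] < 0 -> 0 < p.[1 / 2] ->
  exists2 b, 0 < b < 1 / 2 & p.[b] = 0.
Proof.
move=> p0 p2; have [||b /andP[b0 b2] /rootP pb] := @poly_ivt R p 0 (1 / 2); [lra|lra|].
exists b => //; apply/andP; split; rewrite lt_neqAle ?b0 ?b2 andbT; apply/negP => /eqP E.
  by move: pb p0; rewrite -E => ->; rewrite ltxx.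
by move: p2; rewrite -E pb ltxx.
Qed.

Lemma ex_b_n q : -1 < q -> q < - (7 / 8) -> exists2 b, 0 < b < 1 / 2 & n_param b = q.
Proof.
move=> q1 q8.
pose p : {poly R} := 'X^4 * (3%:P - 2 *: 'X) - (4 * (1 + q)) *: (1 - 'X) ^+ 2.
have pE x : p.[x] = x ^+ 4 * (3 - 2 * x) - 4 * (1 + q) * (1 - x) ^+ 2.
  by rewrite /p !(hornerD, hornerN, hornerM, hornerZ, horner_exp, hornerXn, hornerX, hornerC).
have [||b bI] := @ex_b_poly p; rewrite ?pE; [lra|lra|].
move=> pb; exists b => //; rewrite /n_param.
have bn : 1 - b != 0 by rewrite gt_eqF//; lra.
have -> : b ^+ 4 * (3 - 2 * b) = 4 * (1 + q) * (1 - b) ^+ 2 by lra.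
by field.
Qed.

Lemma ex_b_e e : -1 < e -> e < - (3 / 4) -> exists2 b, 0 < b < 1 / 2 & e_param b = e.
Proof.
move=> q1 q8.
pose p : {poly R} := 'X^3 * (2 *: 'X^2 - 9 *: 'X + 8%:P) - (8 * (1 + e)) *: (1 - 'X) ^+ 2.
have pE x : p.[x] = x ^+ 3 * (2 * x ^+ 2 - 9 * x + 8) - 8 * (1 + e) * (1 - x) ^+ 2.
  by rewrite /p !(hornerD, hornerN, hornerM, hornerZ, horner_exp, hornerXn, hornerX, hornerC).
have [||b bI] := @ex_b_poly p; rewrite ?pE; [lra|lra|].
move=> pb; exists b => //; rewrite /e_param.
have bn : 1 - b != 0 by rewrite gt_eqF//; lra.
have -> : b ^+ 3 * (2 * b ^+ 2 - 9 * b + 8) = 8 * (1 + e) * (1 - b) ^+ 2 by lra.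
by field.
Qed.

Lemma ex_b_lambda y : -1 < y -> y < - (5 / 8) -> exists2 b, 0 < b < 1 / 2 & lambda_param b = y.
Proof.
move=> q1 q8.
pose p : {poly R} := (2%:P - 'X) * 'X^3 - (1 + y) *: (1 - 'X).
have pE x : p.[x] = (2 - x) * x ^+ 3 - (1 + y) * (1 - x).
  by rewrite /p !(hornerD, hornerN, hornerM, hornerZ, hornerXn, hornerX, hornerC).
have [||b bI] := @ex_b_poly p; rewrite ?pE; [lra|lra|].
move=> pb; exists b => //; rewrite /lambda_param.
have bn : 1 - b != 0 by rewrite gt_eqF//; lra.
have -> : (2 - b) * b ^+ 3 = (1 + y) * (1 - b) by lra.
by field.
Qed.

Lemma ex_w_lambda y : - (5 / 8) <= y <= 1 ->
  exists2 w, 1 / 2 <= w <= 1 & y = 4 * w ^+ 3 - 2 * w ^+ 4 - 1.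
Proof.
move=> yI; pose p : {poly R} := 4 *: 'X^3 - 2 *: 'X^4 - (1 + y)%:P.
have pE x : p.[x] = 4 * x ^+ 3 - 2 * x ^+ 4 - (1 + y).
  by rewrite /p !(hornerD, hornerN, hornerZ, hornerXn, hornerC).
have [||w wI /rootP pw] := @poly_ivt R p (1 / 2) 1; [lra|rewrite !pE; lra|].
by exists w => //; rewrite pE in pw; lra.
Qed.

Lemma lambda_A_lt x y : 0 <= x -> x < y -> y <= 1 ->
  4 * x ^+ 3 - 2 * x ^+ 4 - 1 < 4 * y ^+ 3 - 2 * y ^+ 4 - 1.
Proof.
move=> x0 xy y1; rewrite ltrD2r.
have E (z : R) : 4 * z ^+ 3 - 2 * z ^+ 4 = 2 * (z ^+ 2 * (z * (2 - z))) by ring.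
have g : 0 < y * (2 - y) - x * (2 - x).
  rewrite (_ : _ - _ = (y - x) * (2 - (x + y))); last ring.
  by apply: mulr_gt0; lra.
rewrite !E ltr_pM2l//; apply: ltr_pM.
- exact: sqr_ge0.
- by apply: mulr_ge0; lra.
- by rewrite ltrXn2//; lra.
- by rewrite -subr_gt0.
Qed.

(** One case split for the facts about [Lambda]: each case records the parameter together with the
    value of [Lambda], so that neither fractional powers nor [pinv] must be unfolded again. *)
Variant param_spec q : Prop :=
| ParamA w of - (7 / 8) <= q & w = ((1 + q) / 2) `^ (1 / 4) & 1 / 2 <= w <= 1
    & q = 2 * w ^+ 4 - 1 & Lambda q = 4 * w ^+ 3 - 2 * w ^+ 4 - 1
| ParamB b of q < - (7 / 8) & 0 < b < 1 / 2 & n_param b = q & Lambda q = lambda_param b.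

Lemma paramP q : -1 < q <= 1 -> param_spec q.
Proof.
move=> /andP[q0 q1]; have [q8|q8] := leP (- (7 / 8)) q.
  have [|wI qE] := @ex_w_n q; first by rewrite q8 q1.
  by apply: (ParamA q8 erefl wI qE); rewrite {1}qE Lambda_A.
have [b bI bq] := ex_b_n q0 q8.
by apply: (ParamB q8 bI bq); rewrite -bq Lambda_B.
Qed.

(** On the boundary nu(C^T) = q and nu(C) = Lambda q, so eta is their half-sum and nu(C) - eta their
    half-difference. In either parameter this is a rational identity. *)
Lemma Upsilon_Lambda q : -1 <= q <= 1 -> Upsilon ((q + Lambda q) / 2) = (Lambda q - q) / 2.
Proof.
move=> /andP[]; rewrite le_eqVlt => /predU1P[<- _|q0 q1].
  rewrite Lambda_N1 (_ : (-1 + -1) / 2 = -1); last by field.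
  by rewrite Upsilon_N1 subrr mul0r.
case: (@paramP q); first by rewrite q0 q1.
  move=> w _ _ wI qE ->; rewrite {}qE.
  have -> : (2 * w ^+ 4 - 1 + (4 * w ^+ 3 - 2 * w ^+ 4 - 1)) / 2 = 2 * w ^+ 3 - 1 by field.
  by rewrite Upsilon_A//; field.
move=> b _ bI <- ->; have bn : 1 - b != 0 by rewrite gt_eqF//; lra.
have -> : (n_param b + lambda_param b) / 2 = e_param b.
  by rewrite /n_param /lambda_param /e_param; field.
by rewrite Upsilon_B// /n_param /lambda_param /upsilon_param; field.
Qed.

(** Each line n + m = 2 e meets the boundary curve, so that the band condition, stated in e, can be
    read at a point of that curve. *)
Lemma ex_Lambda_mid e : -1 <= e <= 1 -> exists2 q, -1 <= q <= 1 & (q + Lambda q) / 2 = e.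
Proof.
move=> /andP[]; rewrite le_eqVlt => /predU1P[<- _|e0 e1].
  by exists (-1); [lra|rewrite Lambda_N1; field].
have [e4|e4] := leP (- (3 / 4)) e.
  have [|w wI ->] := @ex_w_e e; first by rewrite e4 e1.
  exists (2 * w ^+ 4 - 1); last by rewrite Lambda_A//; field.
  have /andP[w2 w1] := wI.
  have := exprn_ge0 4 (ltac:(lra) : 0 <= w); have : w ^+ 4 <= 1 by rewrite exprn_ile1//; lra.
  lra.
have [b bI <-] := ex_b_e e0 e4.
have /andP[n1 n2] := param_itv bI n_param0 n_param_half n_param_lt.
have bn : 1 - b != 0 by rewrite gt_eqF//; lra.
exists (n_param b); first lra.
by rewrite Lambda_B// /n_param /lambda_param /e_param; field.
Qed.

Lemma Lambda_gtN1 q : -1 < q <= 1 -> -1 < Lambda q.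
Proof.
move=> /paramP[w _ _ wI _ -> |b _ bI _ ->].
  by have := @lambda_A_lt 0 w; rewrite !expr0n /= !mulr0; lra.
by have /andP[] := param_itv bI lambda_param0 lambda_param_half lambda_param_lt.
Qed.

(** On each branch both the argument and the value increase with the parameter; the branches meet at
    the argument -7/8 with common value -5/8. *)
Lemma Lambda_lt x y : -1 <= x -> x < y -> y <= 1 -> Lambda x < Lambda y.
Proof.
rewrite le_eqVlt => /predU1P[<-|x0] xy y1.
  by rewrite Lambda_N1; apply: Lambda_gtN1; rewrite xy.
case: (@paramP x); first by rewrite x0 (le_trans (ltW xy)).
  move=> w x8 _ wI xE ->; case: (@paramP y); first by rewrite y1 (lt_trans x0).
    move=> w' _ _ wI' yE ->; apply: lambda_A_lt; [lra| |lra].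
    by rewrite -(@ltrXn2 _ _ 4)//; lra.
  by move=> b y8 _ _; lra.
move=> b x8 bI bx ->.
have /andP[l1 l2] := param_itv bI lambda_param0 lambda_param_half lambda_param_lt.
case: (@paramP y); first by rewrite y1 (lt_trans x0).
  move=> w _ _ wI _ ->; apply: (lt_le_trans l2).
  have /andP[] := wI; rewrite le_eqVlt => /predU1P[<- _|w2 w1]; first lra.
  by have := @lambda_A_lt (1 / 2) w; lra.
move=> b' _ bI' by' ->; apply: lambda_param_lt; [lra| |lra].
rewrite ltNge; apply/negP; rewrite le_eqVlt => /predU1P[bb|bb].
  by move: xy; rewrite -bx -by' bb ltxx.
have := @n_param_lt b' b; rewrite bx by'; lra.
Qed.

Lemma Lambda_le x y : -1 <= x <= 1 -> -1 <= y <= 1 -> (Lambda x <= Lambda y) = (x <= y).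
Proof.
move=> xI yI; apply/idP/idP; last first.
  by rewrite le_eqVlt => /predU1P[->//|xy]; apply/ltW/Lambda_lt; lra.
by apply: contraTT; rewrite -!ltNge => yx; apply: Lambda_lt; lra.
Qed.

Lemma Lambda_ge q : -1 <= q <= 1 -> q <= Lambda q.
Proof.
move=> /andP[]; rewrite le_eqVlt => /predU1P[<- _|q0 q1]; first by rewrite Lambda_N1.
case: (@paramP q); first by rewrite q0 q1.
  move=> w _ _ wI -> ->.
  have : w ^+ 4 <= w ^+ 3 by rewrite exprSr ler_piMr ?exprn_ge0//; lra.
  lra.
move=> b _ bI <- ->; rewrite -subr_ge0.
have bn : 1 - b != 0 by rewrite gt_eqF//; lra.
have -> : lambda_param b - n_param b
    = b ^+ 3 * (6 * b ^+ 2 - 15 * b + 8) / (4 * (1 - b) ^+ 2).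
  by rewrite /n_param /lambda_param; field.
have b20 := sqr_ge0 b.
by rewrite divr_ge0 ?mulr_ge0 ?exprn_ge0//; lra.
Qed.

Lemma ex_Lambda y : -1 <= y <= 1 -> exists2 q, -1 <= q <= 1 & Lambda q = y.
Proof.
move=> /andP[]; rewrite le_eqVlt => /predU1P[<- _|y0 y1].
  by exists (-1); [lra|rewrite Lambda_N1].
have [y5|y5] := leP (- (5 / 8)) y.
  have [|w wI ->] := @ex_w_lambda y; first by rewrite y5 y1.
  exists (2 * w ^+ 4 - 1); last by rewrite Lambda_A.
  have /andP[w2 w1] := wI.
  have : 0 <= w ^+ 4 by rewrite exprn_ge0//; lra.
  have : w ^+ 4 <= 1 by rewrite exprn_ile1//; lra.
  lra.
have [b bI <-] := ex_b_lambda y0 y5.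
have /andP[n1 n2] := param_itv bI n_param0 n_param_half n_param_lt.
by exists (n_param b); [lra|rewrite Lambda_B].
Qed.

Lemma Lambda_invP y : -1 <= y <= 1 ->
  -1 <= Lambda_inv y <= 1 /\ Lambda (Lambda_inv y) = y.
Proof.
move=> /ex_Lambda[q qI <-].
have -> : Lambda_inv (Lambda q) = q.
  apply: pinvKV; last by rewrite inE /= in_itv.
  move=> u v; rewrite !inE /= !in_itv /= => uI vI uv.
  by apply/eqP; rewrite eq_le -(Lambda_le uI vI) -(Lambda_le vI uI) uv lexx.
by [].
Qed.

(* With e = (n + m) / 2 written as (q + Lambda q) / 2, the band of half-width
   Upsilon e = (Lambda q - q) / 2 is the condition min n m >= q. *)
Lemma regionE n m : -1 <= n <= 1 -> -1 <= m <= 1 ->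
  (`|n - m| <= 2 * Upsilon ((n + m) / 2)) = (m <= Lambda n) && (n <= Lambda m).
Proof.
move=> nI mI; have [|q qI qe] := @ex_Lambda_mid ((n + m) / 2); first lra.
rewrite -qe Upsilon_Lambda// {1}mulrC divfK//.
have [qn qm] : (q <= n) = (Lambda q <= Lambda n) /\ (q <= m) = (Lambda q <= Lambda m).
  by rewrite !Lambda_le.
have gn := Lambda_ge nI; have gm := Lambda_ge mI.
rewrite ler_norml; apply/idP/idP => /andP[h1 h2].
  (* Combined with n + m = q + Lambda q, the two sides of the band say n >= q and m >= q; hence m =
     q + Lambda q - n <= Lambda q <= Lambda n, and symmetrically for n. *)
  have /esym : q <= n by lra.
  have /esym : q <= m by lra.
  by rewrite qn qm => /esym ? /esym ?; lra.
(* If one side of the band fails, one coordinate drops below q and the other exceeds Lambda q,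
   against monotonicity of [Lambda]. *)
apply/andP; split; rewrite leNgt; apply/negP => h.
  have : Lambda n < Lambda q by rewrite ltNge -qn -ltNge; lra.
  lra.
have : Lambda m < Lambda q by rewrite ltNge -qm -ltNge; lra.
lra.
Qed.

End lambda_upsilon.

(** * The attainable region *)

Section extremal_boundary.
Context {R : realType}.
Implicit Types C D G : R -> R -> R.
Local Opaque blest joint_cdf.

(** The one extremal problem behind both halves of the theorem. Its solution at n, transposed, is
    the maximizer of nu(C^T) given nu(C) = n; its solution at Lambda^-1(n) is the minimizer. *)
Definition dominates q D : Prop :=
  [/\ is_copula D, blest (transpose D) = q, blest D = Lambda q
    & forall C, is_copula C -> blest (transpose C) = q ->
        blest C <= Lambda q /\ (blest C = Lambda q -> eq_copula C D)].

(** Under nu(C^T) = nu(D^T) = q the terms in [m] cancel, in the inequality and in its equality case,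
    whatever the value of [m]. *)
Lemma dominates_lagrangian D q p (m : R) : is_copula D ->
  blest D = p -> blest (transpose D) = q -> Lambda q = p ->
  (forall C, is_copula C ->
    blest C - m * blest (transpose C) <= blest D - m * blest (transpose D) /\
    (blest C - m * blest (transpose C) = blest D - m * blest (transpose D) ->
     eq_copula C D)) ->
  dominates q D.
Proof.
move=> cD Dp Dq Lq H; split => //; first by rewrite Lq.
move=> C cC Cq; have [Hle Heq] := H C cC.
by rewrite Cq Dq lerD2r Dp -Lq in Hle Heq; split => // CL; apply: Heq; rewrite CL.
Qed.

Lemma dominates_A q w : 1 / 2 <= w <= 1 -> q = 2 * w ^+ 4 - 1 ->
  Lambda q = 4 * w ^+ 3 - 2 * w ^+ 4 - 1 -> dominates q (A_copula w).
Proof.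
move=> wI qE LE; have w01 : 0 <= w <= 1 by lra.
have [E1 E2] := blest_A_copula w01; rewrite -qE in E2.
apply: (dominates_lagrangian (A_copula_is_copula w01) E1 E2 LE) => C cC.
exact: A_copula_transport wI cC.
Qed.

Lemma dominates_B q b : 0 < b < 1 / 2 -> n_param b = q -> Lambda q = lambda_param b ->
  dominates q (B_copula b).
Proof.
move=> bI qE LE; have [E1 E2] := blest_B_copula bI; rewrite qE in E2.
apply: (dominates_lagrangian (B_copula_is_copula bI) E1 E2 LE) => C cC.
exact: B_copula_transport bI cC.
Qed.

Lemma W_is_copula : is_copula (@W_copula R).
Proof.
apply: (eq_is_copula (eq_copula_sym W_copulaE)).
apply: joint_cdf_copula; first exact: uniform_rv_onem.
exact: uniform_rv_1B uniform_rv_onem.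
Qed.

Lemma transpose_W : transpose (@W_copula R) = W_copula.
Proof.
by apply/funext => u; apply/funext => v; rewrite /transpose /W_copula (addrC v).
Qed.

Lemma blest_W : blest (@W_copula R) = -1.
Proof. by rewrite -(eq_blest W_copulaE); exact: blest_countermonotone. Qed.

(** At q = -1 the constraint alone leaves no choice: the equality case of [blest_min], applied to
    the transpose, makes C equal to W. *)
Lemma dominates_W : dominates (-1) W_copula.
Proof.
split; rewrite ?transpose_W ?Lambda_N1 ?blest_W//; first exact: W_is_copula.
move=> C cC CT; have [_ /(_ CT) H] := blest_min (is_copula_transpose cC).
have {}H : eq_copula C W_copula by rewrite -transpose_W; exact: eq_copula_transpose H.
by rewrite (eq_blest H) blest_W.
Qed.

Lemma ex_dominates q : -1 <= q <= 1 -> exists D, dominates q D.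
Proof.
move=> /andP[]; rewrite le_eqVlt => /predU1P[<- _|q0 q1].
  by exists W_copula; exact: dominates_W.
case: (@paramP _ q); first by rewrite q0 q1.
  by move=> w _ _ wI qE LE; exists (A_copula w); exact: dominates_A.
by move=> b _ bI qE LE; exists (B_copula b); exact: dominates_B.
Qed.

Lemma upper_extremizer_values C q : -1 <= q <= 1 -> is_copula C ->
  blest (transpose C) = q -> blest C = Lambda q -> upper_extremizer C.
Proof.
move=> qI cC Cq CL; split => //; rewrite /Defs.eta CL Cq (addrC (Lambda q)) Upsilon_Lambda//.
by move: (Lambda q) => L; field.
Qed.

(** At w = 1 the multiplier is 1/2 and A_1 has both values 1, so nu(C) - nu(C^T) / 2 <= 1/2 and
    likewise with C and C^T exchanged; the first bound plus half of the second gives the claim. The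
    bound by [Lambda] cannot serve here, since its use presupposes values in [-1, 1]. *)
Lemma blest_le1 C : is_copula C -> blest C <= 1.
Proof.
have m1 : muA (1 : R) = 1 / 2 by rewrite /muA; field.
have I1 : 1 / 2 <= (1 : R) <= 1 by lra.
have I2 : 0 <= (1 : R) <= 1 by lra.
have [E1 E2] := blest_A_copula I2; rewrite !expr1n in E1 E2.
have lin (x y a b : R) : a = 4 * 1 - 2 * 1 - 1 -> b = 2 * 1 - 1 ->
  x - 1 / 2 * y <= a - 1 / 2 * b -> y - 1 / 2 * x <= a - 1 / 2 * b -> x <= 1.
  by clear => -> ->; lra.
move=> cC; have [H1 _] := A_copula_transport I1 cC.
have [H2 _] := A_copula_transport I1 (is_copula_transpose cC).
by rewrite transposeK m1 in H2; rewrite m1 in H1; exact: lin E1 E2 H1 H2.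
Qed.

Lemma blest_itv C : is_copula C -> -1 <= blest C <= 1.
Proof. by move=> cC; rewrite blest_le1// andbT; have [] := blest_min cC. Qed.

Lemma blest_Lambda C : is_copula C -> blest C <= Lambda (blest (transpose C)).
Proof.
move=> cC; have [D [_ _ _ H]] := ex_dominates (blest_itv (is_copula_transpose cC)).
by have [] := H C cC erefl.
Qed.

Lemma transpose_mixture C D (t : R) :
  transpose (fun u v => t * C u v + (1 - t) * D u v) =
  (fun u v => t * transpose C u v + (1 - t) * transpose D u v).
Proof. by []. Qed.

Lemma region_attained (n m : R) : -1 <= n <= 1 -> -1 <= m <= 1 ->
  m <= Lambda n -> n <= Lambda m ->
  exists C, [/\ is_copula C, blest C = n & blest (transpose C) = m].
Proof.
move=> nI mI mn nm.
have mid : -1 <= (n + m) / 2 <= 1 by lra.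
have [q qI qe] := ex_Lambda_mid mid.
have reg : `|n - m| <= Lambda q - q.
  have := regionE nI mI; rewrite mn nm /= -qe Upsilon_Lambda// mulrC divfK//.
have [D [cD DT DL _]] := ex_dominates qI.
(* D and its transpose sit at (Lambda q, q) and (q, Lambda q). The segment between them is the part
   of the line n + m = q + Lambda q inside the region; it may shrink to a point, where the weight
   [t] would divide by zero. *)
have [Lq|Lq] := eqVneq (Lambda q) q.
  have nq : n = q /\ m = q.
    by move: reg; rewrite Lq subrr ler_norml => /andP[]; move: qe; rewrite Lq; clear; split; lra.
  by exists D; case: nq => -> ->; rewrite DL DT Lq.
(* The weight that gives the first coordinate n; the second is then fixed by the sum n + m. *)
pose t := (n - q) / (Lambda q - q).
have d0 : 0 < Lambda q - q.
  by rewrite subr_gt0 lt_neqAle eq_sym Lq Lambda_ge.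
have t01 : 0 <= t <= 1.
  move: reg; rewrite ler_norml => /andP[r1 r2].
  rewrite /t divr_ge0 ?(ltW d0)//= ?ler_pdivrMr// ?mul1r; clear -r1 r2 qe; lra.
have nE : t * Lambda q + (1 - t) * q = n.
  by rewrite /t; field; rewrite subr_eq0.
have [cM bM] := mixture_copula t01 cD (is_copula_transpose cD).
have [_ bM'] := mixture_copula t01 (is_copula_transpose cD) cD.
exists (fun u v => t * D u v + (1 - t) * transpose D u v); split => //.
  by rewrite bM DL DT.
rewrite transpose_mixture transposeK bM' DL DT.
clear -nE qe; lra.
Qed.

Lemma itvE (x : R) : (x \in `[-1, 1]) = (-1 <= x <= 1).
Proof. by rewrite in_itv. Qed.

Lemma blest_range :
  [set (blest C, blest (transpose C)) | C in [set C : R -> R -> R | is_copula C]]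
  = [set p : R * R | [/\ p.1 \in `[-1, 1], p.2 \in `[-1, 1]
       & `|p.1 - p.2| <= 2 * Upsilon ((p.1 + p.2) / 2)]].
Proof.
apply/seteqP; split => [_ [C /= cC <-]|[n m]] /=; rewrite !itvE.
  have I1 := blest_itv cC; have I2 := blest_itv (is_copula_transpose cC).
  split => //; rewrite regionE// blest_Lambda// andbT.
  by have := blest_Lambda (is_copula_transpose cC).
move=> [nI mI]; rewrite regionE// => /andP[mn nm].
have [C [cC <- <-]] := region_attained nI mI mn nm.
by exists C.
Qed.

Lemma Lambda_inv_le (n m : R) : -1 <= n <= 1 -> -1 <= m <= 1 ->
  (Lambda_inv n <= m) = (n <= Lambda m).
Proof.
by move=> nI mI; have [iI {2}<-] := Lambda_invP nI; rewrite Lambda_le.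
Qed.

Lemma region_Lambda_inv :
  [set p : R * R | [/\ p.1 \in `[-1, 1], p.2 \in `[-1, 1]
       & `|p.1 - p.2| <= 2 * Upsilon ((p.1 + p.2) / 2)]]
  = [set p : R * R | [/\ p.1 \in `[-1, 1], p.2 \in `[-1, 1]
       & Lambda_inv p.1 <= p.2 <= Lambda p.1]].
Proof.
apply/seteqP; split => -[n m] /=; rewrite !itvE => -[nI mI];
  by rewrite regionE// Lambda_inv_le// andbC.
Qed.

(** * Maximizers and minimizers for a prescribed value of nu *)

Lemma is_maximum_unique (S : set R) x y : is_maximum S x -> is_maximum S y -> x = y.
Proof.
by move=> [Sx ux] [Sy uy]; apply/eqP; rewrite eq_le uy// ux.
Qed.

Lemma is_minimum_unique (S : set R) x y : is_minimum S x -> is_minimum S y -> x = y.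
Proof.
by move=> [Sx ux] [Sy uy]; apply/eqP; rewrite eq_le ux// uy.
Qed.

Lemma maximum_Lambda (n : R) : -1 <= n <= 1 ->
  is_maximum (blest_transpose_values n) (Lambda n).
Proof.
move=> nI; have [D [cD DT DL _]] := ex_dominates nI; split.
  exists (transpose D); last by rewrite transposeK.
  by split; [exact: is_copula_transpose|].
move=> _ [C [cC <-] <-].
exact: blest_Lambda (is_copula_transpose cC).
Qed.

Lemma minimum_Lambda_inv (n : R) : -1 <= n <= 1 ->
  is_minimum (blest_transpose_values n) (Lambda_inv n).
Proof.
move=> nI; have [mI mE] := Lambda_invP nI.
have [D [cD DT DL _]] := ex_dominates mI; split.
  by exists D => //; split => //; rewrite DL.
move=> _ [C [cC Cn] <-]; rewrite Lambda_inv_le//.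
  by rewrite -Cn; exact: blest_Lambda.
exact: blest_itv (is_copula_transpose cC).
Qed.

(** Transposing C turns nu(C) = n into the constraint of [dominates n], and attaining the maximum
    Lambda n is the equality case there. *)
Lemma maximizerP n C D : -1 <= n <= 1 -> dominates n D ->
  maximizer n C -> eq_copula C (transpose D).
Proof.
move=> nI [_ _ _ H] [cC Cn Cmax].
have CL := is_maximum_unique Cmax (maximum_Lambda nI).
have [_ /(_ CL)] := H _ (is_copula_transpose cC) Cn.
exact: eq_copula_transpose.
Qed.

Lemma maximizer_transpose n D : -1 <= n <= 1 -> dominates n D -> maximizer n (transpose D).
Proof.
move=> nI [cD DT DL _]; split => //; first exact: is_copula_transpose.
by rewrite transposeK DL; exact: maximum_Lambda.
Qed.

Lemma minimizer_values n C : -1 <= n <= 1 -> minimizer n C ->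
  blest (transpose C) = Lambda_inv n /\ blest C = Lambda (Lambda_inv n).
Proof.
move=> nI [cC Cn Cmin]; split; last by rewrite Cn; have [] := Lambda_invP nI.
exact: is_minimum_unique Cmin (minimum_Lambda_inv nI).
Qed.

(** With m = Lambda^-1(n) the prescribed value n is Lambda m, so a minimizer, for which nu(C^T) = m,
    is an equality case of [dominates m]. *)
Lemma minimizerP n C D : -1 <= n <= 1 -> dominates (Lambda_inv n) D ->
  minimizer n C -> eq_copula C D.
Proof.
move=> nI [_ _ _ H] Cmin; have [CT CL] := minimizer_values nI Cmin.
have [cC _ _] := Cmin.
by have [_ /(_ CL)] := H _ cC CT.
Qed.

Lemma minimizer_dominates n D : -1 <= n <= 1 -> dominates (Lambda_inv n) D -> minimizer n D.
Proof.
move=> nI [cD DT DL _]; split => //; first by rewrite DL; have [] := Lambda_invP nI.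
by rewrite DT; exact: minimum_Lambda_inv.
Qed.

End extremal_boundary.

Theorem corollary4p6 (R : realType) :
  [/\ [set (blest C, blest (transpose C)) | C in [set C : R -> R -> R | is_copula C]]
      = [set p : R * R | [/\ p.1 \in `[-1, 1], p.2 \in `[-1, 1]
           & `|p.1 - p.2| <= 2 * Upsilon ((p.1 + p.2) / 2)]],
      [set p : R * R | [/\ p.1 \in `[-1, 1], p.2 \in `[-1, 1]
           & `|p.1 - p.2| <= 2 * Upsilon ((p.1 + p.2) / 2)]]
      = [set p : R * R | [/\ p.1 \in `[-1, 1], p.2 \in `[-1, 1]
           & Lambda_inv p.1 <= p.2 <= Lambda p.1]]
    & forall n : R, n \in `[-1, 1] ->
      [/\ is_maximum (blest_transpose_values n) (Lambda n)
            /\ is_minimum (blest_transpose_values n) (Lambda_inv n),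
          exactly_one_copula (maximizer n) /\ exactly_one_copula (minimizer n),
          n = -1 ->
            (forall C, maximizer n C -> eq_copula C W_copula)
            /\ (forall C, minimizer n C -> eq_copula C W_copula),
          -1 < n -> forall C, maximizer n C ->
            (- (7 / 8) <= n ->
               upper_extremizer (A_copula (((1 + n) / 2) `^ (1 / 4)))
               /\ eq_copula C (transpose (A_copula (((1 + n) / 2) `^ (1 / 4)))))
            /\ (n < - (7 / 8) ->
               exists b : R, [/\ b_range b, n_param b = n,
                 upper_extremizer (B_copula b)
                 & eq_copula C (transpose (B_copula b))])
        & -1 < n -> forall C, minimizer n C ->
            upper_extremizer C
            /\ ((exists2 w : R, w \in `[1 / 2, 1] & eq_copula C (A_copula w))
                \/ (exists2 b : R, b_range b & eq_copula C (B_copula b)))]].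
Proof.
split; [exact: blest_range|exact: region_Lambda_inv|move=> n; rewrite itvE => nI].
have [mI mE] := Lambda_invP nI.
(* At n = -1 both problems thus reduce to [dominates (-1)], whose solution is W. *)
have invN1 : n = -1 -> Lambda_inv n = -1.
  move=> nN1; case/andP: (mI); rewrite le_eqVlt => /predU1P[<-//|m0 m1].
  by have := Lambda_lt (lexx _) m0 m1; rewrite Lambda_N1 mE nN1 ltxx.
have ext q D : -1 <= q <= 1 -> dominates q D -> upper_extremizer D.
  by move=> qI [cD DT DL _]; exact: upper_extremizer_values qI cD DT DL.
split.
- by split; [exact: maximum_Lambda|exact: minimum_Lambda_inv].
- split.
    have [D Dn] := ex_dominates nI; exists (transpose D); split.
      exact: maximizer_transpose.
    by move=> C; exact: maximizerP.
  have [D Dn] := ex_dominates mI; exists D; split; first exact: minimizer_dominates.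
  by move=> C; exact: minimizerP.
- move=> nN1; split => C.
    rewrite -transpose_W; apply: maximizerP => //; rewrite nN1.
    exact: dominates_W.
  by apply: minimizerP => //; rewrite invN1//; exact: dominates_W.
- move=> n0 C Cmax; case: (@paramP _ n); first by rewrite n0; case/andP: nI.
    move=> w n8 -> wI nE LE; have D := dominates_A wI nE LE.
    split; first by split; [exact: ext nI D|exact: maximizerP D Cmax].
    by rewrite ltNge n8.
  move=> b n8 bI bn LE; have D := dominates_B bI bn LE.
  split; first by rewrite leNgt n8.
  move=> _; exists b; split.
  - by rewrite /b_range /= in_itv.
  - exact: bn.
  - exact: ext nI D.
  - exact: maximizerP D Cmax.
- move=> n0 C Cmin; have [CT CL] := minimizer_values nI Cmin; have [cC _ _] := Cmin.
  split; first exact: upper_extremizer_values mI cC CT CL.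
  have m0 : -1 < Lambda_inv n.
    rewrite lt_neqAle eq_sym; case/andP: (mI) => -> _; rewrite andbT.
    by apply/eqP => m1; move: n0; rewrite -mE m1 Lambda_N1 ltxx.
  case: (@paramP _ (Lambda_inv n)); first by rewrite m0; case/andP: mI.
    move=> w _ _ wI nE LE; left; exists w; first by rewrite in_itv.
    exact: minimizerP (dominates_A wI nE LE) Cmin.
  move=> b _ bI bn LE; right; exists b; first by rewrite /b_range /= in_itv.
  exact: minimizerP (dominates_B bI bn LE) Cmin.
Qed.
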